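(* With the notation of the context, for $j=1,\dots,N$ we have $$\hat\alpha(\hat\xi_j(t))=\pi_0^{-(p-1)v_j}\,\frac{H(-v_j)}{[v_j']_{pv_j-v_j'}}\,\hat\xi_j'(t).$$
   Context: For $z\in\mathbb{C}_p$, $l\in\mathbb{Z}$ put $[z]_0=1$; $[z]_l=\frac{1}{(z+1)\cdots(z+l)}$ if $l>0$ and $z\notin\{-1,\dots,-l\}$; $[z]_l=z(z-1)\cdots(z+l+1)$ if $l<0$. Also $(z)_l=z(z+1)\cdots(z+l-1)$ for $l\ge0$. $p$ is a prime; $\mathbb{C}_p$ is the completion of an algebraic closure of $\mathbb{Q}_p$ with norm $|\cdot|$ and valuation $\mathrm{ord}$, $\mathrm{ord}\,p=1$. $v_1,\dots,v_N$ are $p$-integral rational numbers in $[-1,0]$. For each $j$, $v_j'$ is the unique rational number in $[-1,0]$ with $pv_j-v_j'\in\{0,-1,\dots,-(p-1)\}$ (so $v_j'=-1$ if $v_j=-1$, $v_j'=0$ if $v_j=0$). $\pi_0\in\mathbb{C}_p$ is a root of $\sum_{i\ge0}t^{p^i}/p^i=0$ with $\mathrm{ord}\,\pi_0=1/(p-1)$. Fix a positive integer $d$ with $dv_j\in\mathbb{Z}$ for all $j$ and a $d$-th root of $\pi_0$, which defines $\pi_0^r$ for $r\in\frac1d\mathbb{Z}$. Let $C\{t\}$ be the space of formal series $\sum_{l\in\mathbb{Z}}c_lt^l$, $c_l\in\mathbb{C}_p$, with $|c_l|\delta^{|l|}\to0$ as $|l|\to\infty$ for every $0<\delta<1$, and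 $C^-\{t\}$ the subspace of series with $c_l=0$ for $l>0$. Power series in $t$ converging on a disk of radius $>1$ act on $t^{r}C\{t\}$ by multiplication. Let $\Phi$ be the map replacing $t$ by $t^p$, and $\gamma(\sum_{l\in\mathbb{Z}}c_lt^l)=\sum_{l\le-1}c_lt^l$. Let $\theta(t)=\exp(\sum_{i\ge0}(\pi_0t)^{p^i}/p^i)$, $\hat\theta(t)=\prod_{j\ge0}\theta(t^{p^j})$, $\hat\theta_1(t)=\hat\theta(t)/\exp(\pi_0t)$; $\theta(t)$ and $\hat\theta_1(t)$ converge on disks of radius $>1$. Put $$\xi_j(t)=\begin{cases}\sum_{l=-\infty}^\infty[v_j]_l(\pi_0t)^{v_j+l}&\text{if }v_j>-1,\\ \sum_{l=0}^\infty(-1)^l\,l!\,(\pi_0t)^{-1-l}&\text{if }v_j=-1,\end{cases}\qquad \hat\xi_j(t)=\begin{cases}\xi_j(t)\hat\theta_1(t)&\text{if }v_j>-1,\\ \gamma(\xi_j(t)\hat\theta_1(t))&\text{if }v_j=-1,\end{cases}$$ and let $\hat\xi_j'(t)$ be obtained by replacing $v_j$ by $v_j'$ in the definition of $\hat\xi_j(t)$. One has $\hat\xi_j(t)\in t^{v_j}C\{t\}$, and $\hat\xi_j(t)\in t^{-1}C^-\{t\}$ if $v_j=-1$. The operator $\hat\alpha$ is: for $-1<v_j\le0$, $\hat\alpha=\theta(t)\circ\Phi:t^{v_j}C\{t\}\to t^{v_j'}C\{t\}$; for $v_j=-1$, $\hat\alpha=\gamma\circ\theta(t)\circ\Phi:t^{-1}C^-\{t\}\to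 t^{-1}C^-\{t\}$ (where $\theta(t)$ denotes multiplication by $\theta(t)$). Let $\exp(\pi_0t-\pi_0t^p)=\sum_{i\ge0}\sigma_it^i$ and $H(z)=\sum_{l=0}^\infty(-1)^l(z)_l\,\sigma_{pl}\,\pi_0^{-l}$, which converges for $z\in\mathbb{Z}_p$. *)

(* Defs.v *)
From HB Require Import structures.
From mathcomp Require Import all_boot all_order all_algebra.
From mathcomp Require Import all_classical all_reals all_analysis.

Set Implicit Arguments.
Unset Strict Implicit.
Unset Printing Implicit Defensive.

Import Order.TTheory GRing.Theory Num.Theory.
Import numFieldNormedType.Exports.

Local Open Scope classical_set_scope.
Local Open Scope ring_scope.

(* A field with a non-archimedean absolute value in R.  The library's
   [normedZmodType] assumes `|x *+ n| = `|x| *+ n and so excludes these. *)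
Record valuedField (R : realType) := ValuedField {
  vf_field : fieldType;
  vf_abs : vf_field -> R;
  vf_abs_ge0 : forall x, 0 <= vf_abs x;
  vf_abs_eq0 : forall x, (vf_abs x == 0) = (x == 0);
  vf_absM : forall x y, vf_abs (x * y) = vf_abs x * vf_abs y;
  vf_abs_ultra : forall x y, vf_abs (x + y) <= Num.max (vf_abs x) (vf_abs y)
}.

Definition vf_sort (R : realType) (K : valuedField R) : Type := vf_field K.
Coercion vf_sort : valuedField >-> Sortclass.

HB.instance Definition _ (R : realType) (K : valuedField R) :=
  GRing.Field.copy (vf_sort K) (vf_field K).

Definition absv {R : realType} {K : valuedField R} (x : K) : R := vf_abs x.

Section ValuedFieldMetric.
Context {R : realType} {K : valuedField R}.

Lemma absv_ge0 (x : K) : 0 <= absv x.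
Proof. exact: vf_abs_ge0. Qed.

Lemma absv_eq0 (x : K) : (absv x == 0) = (x == 0).
Proof. exact: vf_abs_eq0. Qed.

Lemma absvM (x y : K) : absv (x * y) = absv x * absv y.
Proof. exact: vf_absM. Qed.

Lemma absv_ultra (x y : K) : absv (x + y) <= Num.max (absv x) (absv y).
Proof. exact: vf_abs_ultra. Qed.

Lemma absv0 : absv (0 : K) = 0.
Proof. by apply/eqP; rewrite absv_eq0. Qed.

Lemma absv1 : absv (1 : K) = 1.
Proof.
have n0 : absv (1 : K) != 0 by rewrite absv_eq0 oner_eq0.
by apply: (mulfI n0); rewrite -absvM !mulr1.
Qed.

Lemma absvN (x : K) : absv (- x) = absv x.
Proof.
rewrite -mulN1r absvM.
suff -> : absv (-1 : K) = 1 by rewrite mul1r.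
by apply/eqP; rewrite -sqrp_eq1 ?absv_ge0// expr2 -absvM mulrNN mulr1 absv1.
Qed.

Definition vdist (x y : K) : R := absv (x - y).

Lemma vdistxx x : vdist x x = 0.
Proof. by rewrite /vdist subrr absv0. Qed.

Lemma vdist_eq0 x y : vdist x y = 0 -> x = y.
Proof. by move/eqP; rewrite absv_eq0 subr_eq0 => /eqP. Qed.

Lemma vdist_sym x y : vdist x y = vdist y x.
Proof. by rewrite /vdist -opprB absvN. Qed.

Lemma vdist_triangle y x z : vdist x z <= vdist x y + vdist y z.
Proof.
rewrite /vdist -(subrKA y); apply: (le_trans (absv_ultra _ _)).
by rewrite ge_max lerDl lerDr !absv_ge0.
Qed.

HB.instance Definition _ :=
  isMetric.Build R (vf_sort K) vdistxx vdist_eq0 vdist_sym vdist_triangle.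
HB.instance Definition _ := isPointed.Build (vf_sort K) 0.

End ValuedFieldMetric.

Section Cp.
Context {R : realType} (K : valuedField R).

(* The topological closure of Q in K, for K complete, i.e. the completion
   of Q for the absolute value of K: this is Q_p when it extends the p-adic one. *)
Definition closureQ : set K := closure (range (@ratr K)).

(* The elements of K that are algebraic over [closureQ]. *)
Definition algQ : set K :=
  [set x | exists q : {poly K}, [/\ q != 0, forall i, closureQ q`_i & root q x]].

(* K is a completion of an algebraic closure of Q_p, with ord p = 1.
   [Cp_closed] says that [algQ] is an algebraically closed field, so that it is
   an algebraic closure of [closureQ]. *)
Record is_Cp (p : nat) : Prop := {
  Cp_absp : absv (p%:R : K) = p%:R^-1;
  Cp_complete : forall F : set_system K, ProperFilter F -> cauchy F -> cvg F;
  Cp_closed : forall q : {poly K}, (1 < size q)%N -> (forall i, algQ q`_i) ->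
    exists2 x, algQ x & root q x;
  Cp_dense : dense algQ
}.

Definition ord (p : nat) (x : K) : \bar R :=
  if x == 0 then +oo%E else (- (ln (absv x) / ln p%:R))%:E.

End Cp.

(* A formal power series sum_n a_n t^n is its coefficient sequence. *)
Section PowerSeries.
Context {K : fieldType}.
Implicit Types a b f : nat -> K.

Definition ps_one : nat -> K := fun n => (n == 0%N)%:R.

Definition ps_mul a b : nat -> K := fun n => \sum_(i < n.+1) a i * b (n - i)%N.

Definition ps_exp a k : nat -> K := iter k (ps_mul a) ps_one.

(* sum_k c_k f(t)^k, for f_0 = 0 (so that only k <= n contribute to t^n). *)
Definition ps_comp (c f : nat -> K) : nat -> K :=
  fun n => \sum_(k < n.+1) c k * ps_exp f k n.

Definition ps_expo f : nat -> K := ps_comp (fun k => k`!%:R^-1) f.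

(* The inverse of a, for a_0 = 1: sum_k (1 - a(t))^k. *)
Definition ps_inv a : nat -> K := ps_comp (fun=> 1) (fun n => ps_one n - a n).

(* a(t^m), for m > 0. *)
Definition ps_subst a (m : nat) : nat -> K :=
  fun n => if (m %| n)%N then a (n %/ m)%N else 0.

Definition theta (p : nat) (pi0 : K) : nat -> K :=
  ps_expo (fun n => \sum_(i < n.+1 | n == (p ^ i)%N) pi0 ^+ (p ^ i) / (p ^ i)%:R).

(* prod_(j >= 0) theta(t^(p^j)): the factors with j > n are 1 + O(t^(n+1)). *)
Definition thetahat (p : nat) (pi0 : K) : nat -> K :=
  fun n => (\big[ps_mul/ps_one]_(j < n.+1) ps_subst (theta p pi0) (p ^ j)) n.

Definition thetahat1 (p : nat) (pi0 : K) : nat -> K :=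
  ps_mul (thetahat p pi0)
    (ps_inv (ps_expo (fun n => if n == 1%N then pi0 else 0))).

Definition sigma (p : nat) (pi0 : K) : nat -> K :=
  ps_expo (fun n => (if n == 1%N then pi0 else 0) - (if n == p then pi0 else 0)).

End PowerSeries.

(* [z]_l; the junk value is 0 when l > 0 and z \in {-1, ..., -l}. *)
Definition bracket {K : fieldType} (z : K) (l : int) : K :=
  match l with
  | Posz n => (\prod_(i < n) (z + i.+1%:R))^-1
  | Negz n => \prod_(i < n.+1) (z - i%:R)
  end.

Definition rising {K : fieldType} (z : K) (l : nat) : K :=
  \prod_(i < l) (z + i%:R).

(* pi0 ^ r for r \in (1/d)Z, where varpi is the chosen d-th root of pi0. *)
Definition rpow {K : fieldType} (d : nat) (varpi : K) (r : rat) : K :=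
  varpi ^ Num.floor (d%:R * r).

(* A formal series with rational exponents is the function mapping r : rat to
   the coefficient of t^r; this hosts all the spaces t^v C{t} at once. *)
Section RationalExponents.
Context {R : realType} {K : valuedField R}.
Implicit Types (v r : rat) (c : int -> K) (f : rat -> K).

(* The series sum_(l in Z) c_l t^(v + l). *)
Definition tseries v c : rat -> K :=
  fun r => if r - v \is a Num.int then c (Num.floor (r - v)) else 0.

Definition C_growth c : Prop :=
  forall delta : R, 0 < delta < 1 ->
    ((fun n : nat => absv (c n%:Z) * delta ^+ n) @ \oo --> (0 : R)) /\
    ((fun n : nat => absv (c (- n%:Z)) * delta ^+ n) @ \oo --> (0 : R)).

(* t^v C{t} *)
Definition tC v : set (rat -> K) :=
  [set f | exists2 c, C_growth c & f = tseries v c].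

(* t^v C^-{t} *)
Definition tCminus v : set (rat -> K) :=
  [set f | exists c, [/\ C_growth c, forall l : int, 0 < l -> c l = 0
                      & f = tseries v c]].

(* Multiplication by a power series, with convergent sums in K as coefficients. *)
Definition ts_mul (a : nat -> K) f : rat -> K :=
  fun r => limn (series (fun i => a i * f (r - i%:R))).

Definition Phi (p : nat) f : rat -> K := fun r => f (r / p%:R).

Definition gamma f : rat -> K := fun r => if r <= -1 then f r else 0.

Definition xi (d : nat) (varpi : K) v : rat -> K :=
  if v == -1 then
    tseries (-1) (fun l => if l <= 0 then
      (-1) ^+ `|l|%N * `|l|%N`!%:R * rpow d varpi (-1 + l%:~R) else 0)
  else tseries v (fun l => bracket (ratr v) l * rpow d varpi (v + l%:~R)).

Definition xihat (p d : nat) (pi0 varpi : K) v : rat -> K :=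
  let f := ts_mul (thetahat1 p pi0) (xi d varpi v) in
  if v == -1 then gamma f else f.

Definition alphahat_dom v : set (rat -> K) :=
  if v == -1 then tCminus (-1) else tC v.

Definition alphahat (p : nat) (pi0 : K) v f : rat -> K :=
  let g := ts_mul (theta p pi0) (Phi p f) in
  if v == -1 then gamma g else g.

Definition H (p : nat) (pi0 z : K) : K :=
  limn (series (fun l =>
    (-1) ^+ l * rising z l * sigma p pi0 (p * l)%N * pi0 ^- l)).

End RationalExponents.

(* v' = v_j' for v = v_j; v' is unique for v a p-integral element of [-1, 0]. *)
Definition is_prime_shift (p : nat) (v v' : rat) : Prop :=
  -1 <= v' <= 0 /\ exists2 m : nat, (m < p)%N & p%:R * v - v' = - m%:R.

(* Main.v *)
(* Write xi for the series of v and xi' for that of v'. The formal identity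
   theta(t) hat-theta_1(t^p) = hat-theta_1(t) sigma(t), with sigma = exp(pi0 t - pi0 t^p),
   turns the operator on hat-xi = hat-theta_1 xi into hat-theta_1 (sigma Phi xi), so it
   suffices to show that sigma Phi xi is a multiple of xi'. Both satisfy the first order
   equation (t d/dt - pi0 t) f = 0 (for v = -1, only in the negative exponents), a two-term
   recursion on coefficients whose solutions form a line; the constant is read off from
   the coefficient of t^(p v), which is pi0^v H(-v) for sigma Phi xi.
   All products of two-sided series are justified by two estimates: the coefficients of
   xi grow at most linearly in the exponent, and those of theta, hat-theta_1 and sigma
   decay geometrically. The decay of theta is the integrality of the Artin-Hasse
   exponential, that of hat-theta_1 follows from
   sum_(i <= m) pi0^(p^i)/p^i = - sum_(i > m) pi0^(p^i)/p^i, and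
   sigma = theta hat-theta_1(t^p) / hat-theta_1. *)

(* The recursion r f(r) = pi0 f(r - 1) propagates downwards because pi0 is nonzero, and upwards as
   long as r does not meet 0. Starting at t^(pv) suits both directions. There p v = v' - m with 0 <=
   m < p, so the coefficient of xi' is a power of pi0 times [v']_(-m), a product of m factors. It is
   nonzero because v' = 0 forces m = 0, by p-integrality of v. An exponent r = 0 above p v would
   make v' an integer: v' = 0 is excluded by the same remark, and for v' = -1 only negative
   exponents are compared. The truncations by [gamma] do no harm, since multiplication by a power
   series only raises exponents. The estimates balance because |pi0|^(p-1) = |p|: then |pi0|^n and
   |n!| agree up to a factor linear in n, which gives the linear growth of xi. For the same reason
   exp(f) is under control once the coefficients of f carry one factor |pi0|, which pays for the
   denominators k!. Identities between exponentials are reduced to identities between their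
   logarithms, which are supported on powers of p. *)
Require Import Defs.
From HB Require Import structures.
From mathcomp Require Import all_boot all_order all_algebra.
From mathcomp Require Import all_classical all_reals all_analysis.
From mathcomp Require Import ring lra zify.

Set Implicit Arguments.
Unset Strict Implicit.

Import Order.TTheory GRing.Theory Num.Theory.
Import numFieldNormedType.Exports.
Local Open Scope classical_set_scope.
Local Open Scope ring_scope.

(** * Formal power series *)

Section FormalPowerSeries.
Context {K : fieldType}.
Implicit Types (a b c f g h : nat -> K) (n m k : nat).

(** Truncation to polynomials lets the ring laws of [{poly K}] give those of [ps_mul]. *)
Lemma coef_ps_mul N a b n : (n < N)%N ->
  ps_mul a b n = (\poly_(i < N) a i * \poly_(i < N) b i)`_n.
Proof.
move=> nN; rewrite coefM; apply: eq_bigr => i _.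
rewrite !coef_poly !ifT//; first exact: leq_ltn_trans (leq_subr _ _) nN.
exact: leq_ltn_trans (leq_ord i) nN.
Qed.

Lemma ps_mulC a b : ps_mul a b = ps_mul b a.
Proof. by apply/funext => n; rewrite !(coef_ps_mul _ _ (ltnSn n)) mulrC. Qed.

Lemma ps_mulA a b c : ps_mul a (ps_mul b c) = ps_mul (ps_mul a b) c.
Proof.
apply/funext => n; transitivity
  ((\poly_(i < n.+1) a i * (\poly_(i < n.+1) b i * \poly_(i < n.+1) c i))`_n).
  rewrite coefM; apply: eq_bigr => i _; rewrite coef_poly ltn_ord.
  by rewrite (@coef_ps_mul n.+1)// ltnS leq_subr.
rewrite mulrA coefM; apply: eq_bigr => i _.
by rewrite coef_poly ltnS leq_subr (@coef_ps_mul n.+1).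
Qed.

Lemma ps_mul1 a : ps_mul ps_one a = a.
Proof.
apply/funext => n; rewrite /ps_mul big_ord_recl /= subn0 mul1r big1 ?addr0// => i _.
by rewrite /ps_one /= mul0r.
Qed.

Lemma ps_mul1r a : ps_mul a ps_one = a.
Proof. by rewrite ps_mulC ps_mul1. Qed.

HB.instance Definition _ :=
  Monoid.isComLaw.Build (nat -> K) ps_one ps_mul ps_mulA ps_mulC ps_mul1.

Lemma ps_mulDl a b c : ps_mul (a \+ b) c = ps_mul a c \+ ps_mul b c.
Proof.
apply/funext => n; rewrite /ps_mul /= -big_split.
by apply: eq_bigr => i _; rewrite mulrDl.
Qed.

Lemma ps_mul_coef0 a b : ps_mul a b 0%N = a 0%N * b 0%N.
Proof. by rewrite /ps_mul big_ord_recl big_ord0 addr0. Qed.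

Lemma eq_ps_mul n a a' b b' : (forall i, (i <= n)%N -> a i = a' i) ->
  (forall i, (i <= n)%N -> b i = b' i) -> ps_mul a b n = ps_mul a' b' n.
Proof.
move=> aa bb; apply: eq_bigr => i _; rewrite aa ?leq_ord// bb//.
exact: leq_subr.
Qed.

Lemma eq_ps_exp n f f' k : (forall i, (i <= n)%N -> f i = f' i) ->
  forall i, (i <= n)%N -> ps_exp f k i = ps_exp f' k i.
Proof.
move=> ff; elim: k => [//|k IH] i ni; rewrite /ps_exp !iterS.
apply: eq_ps_mul => j ji; first exact: ff (leq_trans ji ni).
exact: IH (leq_trans ji ni).
Qed.

Lemma eq_ps_comp c n f f' : (forall i, (i <= n)%N -> f i = f' i) ->
  ps_comp c f n = ps_comp c f' n.
Proof. by move=> ff; apply: eq_bigr => k _; rewrite (eq_ps_exp _ ff). Qed.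

Lemma ps_exp_lt f k n : f 0%N = 0 -> (n < k)%N -> ps_exp f k n = 0.
Proof.
move=> f0; elim: k n => [//|k IH] n nk; rewrite /ps_exp iterS /ps_mul.
apply: big1 => -[[|i] /= ilt] _; first by rewrite f0 mul0r.
by rewrite -/(ps_exp f k) IH ?mulr0//; lia.
Qed.

Lemma ps_comp_ge c f n m : f 0%N = 0 -> (n <= m)%N ->
  ps_comp c f n = \sum_(k < m.+1) c k * ps_exp f k n.
Proof.
move=> f0 nm; rewrite /ps_comp (big_ord_widen_cond m.+1 xpredT
  (fun k => c k * ps_exp f k n))// big_mkcond /=; apply: eq_bigr => k _.
by case: ifPn => //; rewrite -leqNgt => ?; rewrite ps_exp_lt ?mulr0.
Qed.

(** The vanishing constant term of [g] shortens the range to k < n. This is the range left in the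
    exponential and geometric series once their term k = 0 is split off. *)
Lemma ps_mul_comp c f g n : f 0%N = 0 -> g 0%N = 0 ->
  ps_mul g (ps_comp c f) n = \sum_(k < n) c k * ps_mul g (ps_exp f k) n.
Proof.
move=> f0 g0; case: n => [|n]; first by rewrite ps_mul_coef0 g0 mul0r big_ord0.
transitivity (\sum_(i < n.+2) g i *
    \sum_(k < n.+1) c k * ps_exp f k (n.+1 - i)).
  apply: eq_bigr => -[[|i] /= ilt] _; first by rewrite g0 !mul0r.
  by rewrite -ps_comp_ge//; lia.
under eq_bigr do rewrite big_distrr /=.
rewrite exchange_big /=; apply: eq_bigr => k _; rewrite big_distrr /=.
by apply: eq_bigr => i _; rewrite mulrCA.
Qed.

(** The Euler derivation t d/dt; unlike d/dt it does not shift indices. *)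
Definition ps_deriv a : nat -> K := fun n => n%:R * a n.

Lemma ps_derivM a b :
  ps_deriv (ps_mul a b) = ps_mul (ps_deriv a) b \+ ps_mul a (ps_deriv b).
Proof.
apply/funext => n; rewrite /= /ps_deriv /ps_mul big_distrr -big_split /=.
apply: eq_bigr => i _; rewrite -{1}(subnKC (leq_ord i)) natrD; ring.
Qed.

Lemma ps_deriv_exp f k n :
  ps_deriv (ps_exp f k.+1) n = k.+1%:R * ps_mul (ps_deriv f) (ps_exp f k) n.
Proof.
elim: k n => [|k IH] n.
  by rewrite /ps_exp /= !ps_mul1r mul1r.
rewrite {1}/ps_exp iterS ps_derivM /= -/(ps_exp f k.+1).
suff -> : ps_mul f (ps_deriv (ps_exp f k.+1)) n =
    k.+1%:R * ps_mul (ps_deriv f) (ps_exp f k.+1) n.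
  by rewrite -[in RHS]natr1 mulrDl mul1r addrC.
rewrite {2}/ps_exp iterS -/(ps_exp f k) ps_mulA [ps_mul _ f]ps_mulC -ps_mulA.
rewrite {1 3}/ps_mul big_distrr /=; apply: eq_bigr => i _.
by rewrite IH mulrCA.
Qed.

Lemma ps_expo_coef0 f : ps_expo f 0%N = 1.
Proof.
by rewrite /ps_expo /ps_comp big_ord_recl big_ord0 /= /ps_one eqxx mulr1 invr1 addr0.
Qed.

Hypothesis char0 : forall n, n.+1%:R != 0 :> K.

Lemma ps_deriv_expo f : f 0%N = 0 ->
  ps_deriv (ps_expo f) = ps_mul (ps_deriv f) (ps_expo f).
Proof.
move=> f0; apply/funext => n.
rewrite /ps_expo ps_mul_comp//; last by rewrite /ps_deriv mul0r.
rewrite /ps_deriv {1}/ps_comp big_ord_recl /= mulrDr big_distrr /=.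
rewrite {1}/ps_exp /= /ps_one; have -> : n%:R * (0`!%:R^-1 * (n == 0%N)%:R) = 0 :> K.
  by case: n => [|n]; rewrite ?mul0r ?mulr0.
rewrite add0r; apply: eq_bigr => k _; rewrite /bump leq0n add1n mulrCA.
have /= := ps_deriv_exp f k n; rewrite {1}/ps_deriv => ->.
by rewrite factS natrM invfM [_^-1 * _^-1]mulrC -mulrA mulKf.
Qed.

(** As h has no constant term, the equation expresses n a_n through earlier coefficients, and n is
    invertible. The identities for [ps_expo] below all rest on this uniqueness. *)
Lemma ps_ode_uniq h a b : h 0%N = 0 -> a 0%N = b 0%N ->
  ps_deriv a = ps_mul h a -> ps_deriv b = ps_mul h b -> a = b.
Proof.
move=> h0 ab0 Da Db; apply/funext => n; elim/ltn_ind: n => -[//|n] IH.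
apply: (mulfI (char0 n)).
have -> : n.+1%:R * a n.+1 = ps_mul h a n.+1 by rewrite -Da.
have -> : n.+1%:R * b n.+1 = ps_mul h b n.+1 by rewrite -Db.
apply: eq_bigr => -[[|i] /= ilt] _; first by rewrite h0 !mul0r.
by rewrite IH//; lia.
Qed.

Lemma ps_expoD f g : f 0%N = 0 -> g 0%N = 0 ->
  ps_mul (ps_expo f) (ps_expo g) = ps_expo (f \+ g).
Proof.
move=> f0 g0; apply: (@ps_ode_uniq (ps_deriv f \+ ps_deriv g)).
- by rewrite /ps_deriv /= !mul0r addr0.
- by rewrite ps_mul_coef0 !ps_expo_coef0 mulr1.
- rewrite ps_derivM !ps_deriv_expo// ps_mulDl; congr (_ \+ _).
    by rewrite ps_mulA.
  by rewrite ps_mulA [ps_mul (ps_expo f) _]ps_mulC ps_mulA.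
- rewrite ps_deriv_expo /= ?f0 ?g0 ?addr0//; congr ps_mul.
  by apply/funext => n; rewrite /ps_deriv /= mulrDr.
Qed.

Lemma ps_expo0 : ps_expo (fun=> 0) = ps_one :> (nat -> K).
Proof.
apply: (@ps_ode_uniq (fun=> 0)) => //.
- by rewrite ps_expo_coef0.
- rewrite ps_deriv_expo//; congr ps_mul.
  by apply/funext => n; rewrite /ps_deriv mulr0.
- by apply/funext => -[|n]; rewrite ps_mul1r /ps_deriv ?mul0r ?mulr0.
Qed.

Lemma ps_mul_inv a : a 0%N = 1 -> ps_mul a (ps_inv a) = ps_one.
Proof.
move=> a0; set u := fun n => ps_one n - a n.
have u0 : u 0%N = 0 by rewrite /u /ps_one a0 subrr.
have aE : a \+ u = ps_one by apply/funext => n; rewrite /u /=; ring.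
(* Multiplying the geometric series of u = 1 - a by u shifts it by one, so removing u * inv from (a
   + u) * inv = inv leaves the term k = 0. *)
apply/funext => n; have := congr1 (@^~ n) (ps_mulDl a u (ps_inv a)).
rewrite aE ps_mul1 /= [ps_mul u _ _]ps_mul_comp// /ps_inv -/u /ps_comp big_ord_recl.
have -> : \sum_(i < n) 1 * ps_exp u (lift ord0 i) n =
          \sum_(k < n) 1 * ps_mul u (ps_exp u k) n by apply: eq_bigr.
by rewrite mul1r => /addIr <-.
Qed.

Lemma ps_inv_expo f : f 0%N = 0 -> ps_inv (ps_expo f) = ps_expo (fun n => - f n).
Proof.
move=> f0; have fN : ps_mul (ps_expo f) (ps_expo (fun n => - f n)) = ps_one.
  rewrite ps_expoD ?f0 ?oppr0// -ps_expo0; congr ps_expo.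
  by apply/funext => n /=; rewrite subrr.
rewrite -[LHS]ps_mul1r -fN ps_mulA [ps_mul (ps_inv _) _]ps_mulC.
by rewrite ps_mul_inv ?ps_expo_coef0// ps_mul1.
Qed.

Lemma ps_exp_expo f k : f 0%N = 0 ->
  ps_exp (ps_expo f) k = ps_expo (fun n => k%:R * f n).
Proof.
move=> f0; elim: k => [|k IH].
  by rewrite /ps_exp -ps_expo0; congr ps_expo; apply/funext => n; rewrite mul0r.
rewrite /ps_exp iterS -/(ps_exp _ _) IH ps_expoD ?f0 ?mulr0//; congr ps_expo.
by apply/funext => n /=; rewrite -natr1 mulrDl mul1r addrC.
Qed.

(** * Substitution of t^m, rescaling of t, and products of exponentials *)

Lemma sum_dvdn m n (F : nat -> K) : (0 < m)%N ->
  \sum_(i < n.+1) (if (m %| i)%N then F (i %/ m)%N else 0) =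
  \sum_(i < (n %/ m).+1) F i.
Proof.
move=> m0; elim: n => [|n IH]; first by rewrite div0n !big_ord1 dvdn0 div0n.
rewrite big_ord_recr /= IH divnS//; case: ifP => mn; rewrite ?addr0 ?add0n//.
by rewrite add1n [in RHS]big_ord_recr /= ?divnS ?mn ?add1n.
Qed.

Lemma ps_substM a b m : (0 < m)%N ->
  ps_subst (ps_mul a b) m = ps_mul (ps_subst a m) (ps_subst b m).
Proof.
move=> m0; apply/funext => n; rewrite {1}/ps_subst.
case: ifPn => [/dvdnP[k ->]|mn].
  rewrite mulnK// mulnC /ps_mul.
  have := @sum_dvdn m (m * k) (fun i => a i * b (k - i)%N) m0; rewrite mulKn// => <-.
  apply: eq_bigr => i _; rewrite /ps_subst; case: ifPn => [/dvdnP[j ij]|_].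
    by rewrite ij mulnK// [(j * m)%N]mulnC -mulnBr dvdn_mulr// mulKn.
  by rewrite mul0r.
rewrite /ps_mul big1// => i _; rewrite /ps_subst; case: ifPn => mi; last by rewrite mul0r.
rewrite ifN ?mulr0//; apply: contra mn => mni.
by rewrite -(subnKC (leq_ord i)) dvdn_add.
Qed.

Lemma ps_deriv_subst a m n :
  ps_deriv (ps_subst a m) n = m%:R * ps_subst (ps_deriv a) m n.
Proof.
rewrite /ps_deriv /ps_subst; case: ifPn => [mn|_]; last by rewrite !mulr0.
by rewrite mulrA -natrM mulnC divnK.
Qed.

Lemma ps_subst_coef0 a m : ps_subst a m 0%N = a 0%N.
Proof. by rewrite /ps_subst dvdn0 div0n. Qed.

Lemma ps_subst_expo f m : (0 < m)%N -> f 0%N = 0 ->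
  ps_subst (ps_expo f) m = ps_expo (ps_subst f m).
Proof.
move=> m0 f0; apply: (@ps_ode_uniq (ps_deriv (ps_subst f m))).
- by rewrite /ps_deriv mul0r.
- by rewrite ps_subst_coef0 !ps_expo_coef0.
- apply/funext => n; rewrite ps_deriv_subst ps_deriv_expo// ps_substM//.
  rewrite /ps_mul big_distrr /=; apply: eq_bigr => i _.
  by rewrite ps_deriv_subst mulrA.
- by rewrite ps_deriv_expo// ps_subst_coef0.
Qed.

Lemma ps_expo_scale (x : K) f : f 0%N = 0 ->
  ps_expo (fun n => x ^+ n * f n) = fun n => x ^+ n * ps_expo f n.
Proof.
move=> f0; apply: (@ps_ode_uniq (fun n => x ^+ n * ps_deriv f n)).
- by rewrite /ps_deriv mul0r mulr0.
- by rewrite ps_expo_coef0 expr0 mul1r ps_expo_coef0.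
- rewrite ps_deriv_expo ?f0 ?mulr0//; congr ps_mul.
  by apply/funext => n; rewrite /ps_deriv mulrCA.
- apply/funext => n; rewrite {1}/ps_deriv mulrCA -/(ps_deriv _ n) ps_deriv_expo//.
  rewrite /ps_mul big_distrr /=; apply: eq_bigr => i _.
  by rewrite -{1}(subnKC (leq_ord i)) exprD; ring.
Qed.

Lemma big_ps_mul_expo (s : seq nat) (F : nat -> nat -> K) :
  (forall j, F j 0%N = 0) ->
  \big[ps_mul/ps_one]_(j <- s) ps_expo (F j) = ps_expo (fun n => \sum_(j <- s) F j n).
Proof.
move=> F0; elim: s => [|j s IH].
  by rewrite big_nil -ps_expo0; congr ps_expo; apply/funext => n; rewrite big_nil.
rewrite big_cons IH ps_expoD//; last exact: big1.
by congr ps_expo; apply/funext => n /=; rewrite big_cons.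
Qed.

End FormalPowerSeries.

(** * Ultrametric sums and multiplication of two-sided series *)

Section UltrametricSums.
Context {R : realType} {K : valuedField R}.
Implicit Types (u a b : nat -> K) (l : K) (e rho : R).

Lemma cvg_absvP u l :
  u @ \oo --> l <-> forall e, 0 < e -> exists N, forall n, (N <= n)%N -> absv (u n - l) < e.
Proof.
have bE (x y : K) e : ball x e y = (absv (x - y) < e) by rewrite ballEmdist.
split=> [ul e e0|ul].
  have [N _ NP] := (proj1 (@cvg_ballP _ _ _ _ _ u l)) ul e e0.
  by exists N => n Nn; have := NP n Nn; rewrite /= bE -absvN opprB.
apply/cvg_ballP => e e0; have [N NP] := ul e e0.
by exists N => // n Nn; rewrite /= bE -absvN opprB; exact: NP.
Qed.

Lemma cvg_absv_lim u l : u @ \oo --> l -> limn u = l.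
Proof. by apply: cvg_lim; exact: metric_hausdorff. Qed.

Lemma absv_sum_le (I : Type) (r : seq I) (P : pred I) (F : I -> K) (B : R) :
  0 <= B -> (forall i, P i -> absv (F i) <= B) -> absv (\sum_(i <- r | P i) F i) <= B.
Proof.
move=> B0 FB; apply: (big_ind (fun x => absv x <= B)) => [|x y xB yB|//].
  by rewrite absv0.
by apply: (le_trans (absv_ultra _ _)); rewrite ge_max xB.
Qed.

Lemma absv_sum_lt (I : Type) (r : seq I) (P : pred I) (F : I -> K) (B : R) :
  0 < B -> (forall i, P i -> absv (F i) < B) -> absv (\sum_(i <- r | P i) F i) < B.
Proof.
move=> B0 FB; apply: (big_ind (fun x => absv x < B)) => [|x y xB yB|//].
  by rewrite absv0.
by apply: (le_lt_trans (absv_ultra _ _)); rewrite gt_max xB.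
Qed.

Lemma absvB_le (x y : K) (B : R) : absv x <= B -> absv y <= B -> absv (x - y) <= B.
Proof.
by move=> xB yB; apply: (le_trans (absv_ultra _ _)); rewrite ge_max absvN xB.
Qed.

Lemma absvB_lt (x y : K) (B : R) : absv x < B -> absv y < B -> absv (x - y) < B.
Proof.
by move=> xB yB; apply: (le_lt_trans (absv_ultra _ _)); rewrite gt_max absvN xB.
Qed.

Lemma absvX (x : K) n : absv (x ^+ n) = absv x ^+ n.
Proof. by elim: n => [|n IH]; rewrite ?expr0 ?absv1// !exprS absvM IH. Qed.

Lemma absvV (x : K) : absv x^-1 = (absv x)^-1.
Proof.
have [->|x0] := eqVneq x 0; first by rewrite invr0 absv0 invr0.
have ax : absv x != 0 by rewrite absv_eq0.
by apply: (mulfI ax); rewrite -absvM !divff// absv1.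
Qed.

Lemma absv_prod (I : Type) (r : seq I) (P : pred I) (F : I -> K) :
  absv (\prod_(i <- r | P i) F i) = \prod_(i <- r | P i) absv (F i).
Proof. exact: (big_morph absv (@absvM _ _) (@absv1 _ _)). Qed.

Lemma absv_nat_le1 n : absv (n%:R : K) <= 1.
Proof.
elim: n => [|n IH]; first by rewrite absv0.
by rewrite -natr1; apply: (le_trans (absv_ultra _ _)); rewrite ge_max IH absv1 lexx.
Qed.

Lemma cvg_series_tail u l n (B : R) : series u @ \oo --> l -> 0 <= B ->
  (forall i, (n <= i)%N -> absv (u i) <= B) -> absv (l - series u n) <= B.
Proof.
move=> /cvg_absvP ul B0 uB; rewrite leNgt; apply/negP => Bl.
(* The distance |d| serves as its own epsilon: a late partial sum is closer to l than |d|, and the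
   terms from n on are too small to make up the difference. *)
have [N NP] := ul _ (le_lt_trans B0 Bl).
set d := l - _ in Bl NP *; pose m := maxn N n.
have : absv d < absv d; last by rewrite ltxx.
have {1}-> : d = (series u m - series u n) - (series u m - l) by rewrite /d; ring.
apply: absvB_lt; last by rewrite NP ?leq_maxl.
apply: le_lt_trans Bl; rewrite sub_series_geq ?leq_maxr// big_nat_cond.
by apply: absv_sum_le => // i /andP[/andP[ni _] _]; exact: uB.
Qed.

Lemma cvg_series_bound u l (B : R) : series u @ \oo --> l ->
  (forall i, absv (u i) <= B) -> absv l <= B.
Proof.
move=> ul uB; rewrite -[l]subr0 -[X in _ - X](_ : series u 0 = 0); last first.
  by rewrite /series /= big_geq.
by apply: cvg_series_tail => //; exact: le_trans (absv_ge0 _) (uB 0%N).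
Qed.

Lemma cvg_seriesZ c u l : series u @ \oo --> l ->
  series (fun i => c * u i) @ \oo --> c * l.
Proof.
move=> /cvg_absvP ul; apply/cvg_absvP => e e0.
have c1 : 0 < 1 + absv c by rewrite ltr_pwDl// absv_ge0.
have [N NP] := ul (e / (1 + absv c)) (divr_gt0 e0 c1).
exists N => n Nn; rewrite /series /= -big_distrr -mulrBr absvM /=.
have := NP n Nn; rewrite ltr_pdivlMr// => ?.
apply: le_lt_trans; last by eassumption.
by rewrite mulrC ler_wpM2l ?absv_ge0// lerDr.
Qed.

Lemma cvg_seriesD u v l m : series u @ \oo --> l -> series v @ \oo --> m ->
  series (fun i => u i + v i) @ \oo --> l + m.
Proof.
move=> /cvg_absvP ul /cvg_absvP vm; apply/cvg_absvP => e e0.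
have [N NP] := ul e e0; have [M MP] := vm e e0.
exists (maxn N M) => n; rewrite geq_max => /andP[Nn Mn].
rewrite /series /= big_split /=.
have -> : forall x y : K, x + y - (l + m) = (x - l) - (m - y) by move=> x y; ring.
by apply: absvB_lt; [exact: NP|rewrite -absvN opprB; exact: MP].
Qed.

Lemma cvg_series_shift u l k : series u @ \oo --> l ->
  series (fun i => if (i < k)%N then 0 else u (i - k)%N) @ \oo --> l.
Proof.
move=> /cvg_absvP ul; apply/cvg_absvP => e e0; have [N NP] := ul e e0.
exists (N + k)%N => n Nn; have -> : n = ((n - k) + k)%N by lia.
rewrite series_addn {1}/series /= big_nat_cond big1 ?add0r; last first.
  by move=> i /andP[/andP[_ ->]].
rewrite -{1}[k]add0n big_addn addnK big_nat_cond.
rewrite (eq_bigr u) => [|i _]; last by rewrite ltnNge leq_addl /= addnK.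
by rewrite -big_nat_cond; apply: NP; lia.
Qed.

Lemma cvg_series_dvdn u l m : (0 < m)%N -> series u @ \oo --> l ->
  series (fun i => if (m %| i)%N then u (i %/ m)%N else 0) @ \oo --> l.
Proof.
move=> m0 /cvg_absvP ul; apply/cvg_absvP => e e0; have [N NP] := ul e e0.
exists (m * N).+1 => -[//|n] Nn; rewrite seriesEord /= (@sum_dvdn _ m n u m0).
by rewrite -(big_mkord xpredT u); apply: NP; rewrite ltnW// ltnS leq_divRL// mulnC.
Qed.

(** This direction yields the convergence of [H], whose terms are the only nonzero ones of a series
    already known to converge. *)
Lemma cvg_series_dvdnV u l m : (0 < m)%N ->
  series (fun i => if (m %| i)%N then u (i %/ m)%N else 0) @ \oo --> l ->
  series u @ \oo --> l.
Proof.
move=> m0 /cvg_absvP ul; apply/cvg_absvP => e e0; have [N NP] := ul e e0.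
exists N.+1 => -[//|n] Nn; rewrite seriesEord /=.
have := @sum_dvdn _ m (m * n) u m0; rewrite mulKn// => <-.
by have := NP (m * n).+1; rewrite seriesEord /=; apply; nia.
Qed.

Lemma sum_triangle (t : nat -> nat -> K) n :
  \sum_(k < n) \sum_(i < k.+1) t i (k - i)%N = \sum_(i < n) \sum_(j < n - i) t i j.
Proof.
elim: n => [|n IH]; first by rewrite !big_ord0.
rewrite big_ord_recr /= IH [RHS]big_ord_recr [X in _ + X]big_ord_recr /= subSnn.
rewrite big_ord1 subnn addrA -big_split; congr (_ + _); apply: eq_bigr => i _ /=.
by rewrite subSn ?(ltnW (ltn_ord i))// big_ord_recr.
Qed.

(** The sums over the triangle i + j < n and over the full rows i < n differ by row tails, all of
    whose terms have i + j >= n. In an ultrametric field the number of these terms does not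
    matter. *)
Lemma cvg_series_triangle (t : nat -> nat -> K) (W : nat -> R) (s : nat -> K) (S : K) :
  (forall i j, absv (t i j) <= W (i + j)%N) ->
  (forall e, 0 < e -> exists N, forall n, (N <= n)%N -> W n < e) ->
  (forall i, series (t i) @ \oo --> s i) -> series s @ \oo --> S ->
  series (fun n => \sum_(i < n.+1) t i (n - i)%N) @ \oo --> S.
Proof.
move=> tW W0 ts /cvg_absvP sS; apply/cvg_absvP => e e0.
have [N NP] := sS e e0; have [M MP] := W0 _ (divr_gt0 e0 (ltr0n R 2)).
exists (maxn N M) => n; rewrite geq_max => /andP[Nn Mn].
rewrite seriesEord /= sum_triangle.
set T := \sum_(i < n) _; have -> : T - S = (series s n - S) - (series s n - T) by ring.
apply: absvB_lt; first exact: NP.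
rewrite seriesEord /T /= -sumrB; apply: absv_sum_lt => // i _.
rewrite -(big_mkord xpredT (t i)); apply: (@le_lt_trans _ _ (e / 2)); last by lra.
apply: cvg_series_tail; [exact: ts|lra|move=> j nj].
by apply: le_trans (tW _ _) (ltW (MP _ _)); have := ltn_ord i; lia.
Qed.

(** * Products of power series with two-sided series over a complete field *)

Hypothesis K_complete : forall F : set_system K, ProperFilter F -> cauchy F -> cvg F.

Lemma cvg_series_vanishing u :
  (forall e, 0 < e -> exists N, forall n, (N <= n)%N -> absv (u n) < e) ->
  series u @ \oo --> limn (series u).
Proof.
move=> u0; apply: K_complete; apply/cauchyP => e e0; have [N NP] := u0 e e0.
exists (series u N); exists N => // n Nn; rewrite /= ballEmdist /=.
rewrite -[mdist _ _]/(absv _) -absvN opprB sub_series_geq// big_nat_cond.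
by apply: absv_sum_lt => // i /andP[/andP[Ni _] _]; exact: NP.
Qed.

(** Convergence on a disk of radius greater than 1, in terms of coefficients. *)
Definition geom_bounded a := exists A rho : R,
  [/\ 0 <= A, 0 < rho < 1 & forall n, absv (a n) <= A * rho ^+ n].

(** This class is stable under [Phi], [gamma] and multiplication by a [geom_bounded] series, and it
    implies [C_growth] on every coset of the integers. *)
Definition lin_growth (f : rat -> K) := exists2 C : R,
  0 <= C & forall r, absv (f r) <= C * (1 + ratr `|r|).

Lemma geom_bounded2 a b : geom_bounded a -> geom_bounded b -> exists A rho : R,
  [/\ 0 <= A, 0 < rho < 1, forall n, absv (a n) <= A * rho ^+ n &
      forall n, absv (b n) <= A * rho ^+ n].
Proof.
move=> [A [x [A0 /andP[x0 x1] aA]]] [B [y [B0 /andP[y0 y1] bB]]].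
exists (Num.max A B), (Num.max x y); split.
- by rewrite le_max A0.
- by rewrite lt_max x0 gt_max x1 y1.
- move=> n; apply: le_trans (aA n) _; apply: ler_pM; rewrite ?exprn_ge0 ?(ltW x0)//.
    by rewrite le_max lexx.
  by rewrite lerXn2r ?nnegrE ?le_max ?(ltW x0) ?lexx.
- move=> n; apply: le_trans (bB n) _; apply: ler_pM; rewrite ?exprn_ge0 ?(ltW y0)//.
    by rewrite le_max lexx orbT.
  by rewrite lerXn2r ?nnegrE ?le_max ?(ltW y0) ?lexx ?orbT.
Qed.

Lemma geom_boundedM a b : geom_bounded a -> geom_bounded b -> geom_bounded (ps_mul a b).
Proof.
move=> ga gb; have [A [rho [A0 rho01 aA bA]]] := geom_bounded2 ga gb.
exists (A * A), rho; split=> // [|n]; first exact: mulr_ge0.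
have rho0 : 0 <= rho by case/andP: rho01 => /ltW.
apply: absv_sum_le => [|i _]; first by rewrite !mulr_ge0// exprn_ge0.
rewrite absvM -[n in rho ^+ n](subnKC (leq_ord i)) exprD mulrACA.
by apply: ler_pM; rewrite ?absv_ge0.
Qed.

Lemma geom_bounded_subst a m : (0 < m)%N -> geom_bounded a -> geom_bounded (ps_subst a m).
Proof.
move=> m0 [A [rho [A0 /andP[rho0 rho1] aA]]].
(* By Bernoulli's inequality (1 - y)^m >= 1 - m y = rho, so 1 - y does the work of an m-th root of
   rho. *)
pose y := (1 - rho) / m%:R; have m0R : 0 < m%:R :> R by rewrite ltr0n.
have m1R : 1 <= m%:R :> R by rewrite ler1n.
have y0 : 0 < y by rewrite divr_gt0// subr_gt0.
have y1 : y < 1 by rewrite ltr_pdivrMr// mul1r; apply: lt_le_trans m1R; lra.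
have yX : rho <= (1 - y) ^+ m.
  have bern k : 1 - k%:R * y <= (1 - y) ^+ k.
    elim: k => [|k IH]; first by rewrite mul0r subr0.
    rewrite exprS; apply: le_trans (ler_wpM2l _ IH); last by lra.
    have : 0 <= k%:R * y * y by rewrite (mulr_ge0 (mulr_ge0 _ _))// ltW.
    rewrite -natr1; lra.
  apply: le_trans (bern m); rewrite /y mulrC divfK ?gt_eqF//; lra.
exists A, (1 - y); split=> // [|n]; first by lra.
rewrite /ps_subst; case: ifPn => [/dvdnP[k ->]|_]; last first.
  by rewrite absv0 mulr_ge0// exprn_ge0//; lra.
rewrite mulnK// mulnC exprM; apply: le_trans (aA k) _.
by rewrite ler_wpM2l// lerXn2r// ?nnegrE ?exprn_ge0//; lra.
Qed.

Lemma expr_lin_bounded rho : 0 < rho < 1 -> exists2 M : R, 0 <= M &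
  forall n, rho ^+ n * (1 + n%:R) <= M.
Proof.
(* Bernoulli's inequality for rho^-1 = 1 + x gives rho^n (1 + n x) <= 1, hence rho^n n <= 1/x. *)
move=> /andP[rho0 rho1]; pose x := rho^-1 - 1.
have x0 : 0 < x by rewrite subr_gt0 invf_gt1.
have bern n : 1 + n%:R * x <= rho ^- n.
  elim: n => [|n IH]; first by rewrite mul0r addr0 expr0 invr1.
  rewrite exprS invfM; apply: le_trans (ler_wpM2l _ IH); last by rewrite invr_ge0 ltW.
  have -> : rho^-1 = 1 + x by rewrite /x; ring.
  rewrite -natr1; have : 0 <= n%:R * x * x by rewrite !mulr_ge0 ?(ltW x0).
  lra.
exists (1 + x^-1) => [|n]; first by rewrite addr_ge0// invr_ge0 ltW.
have r0 : 0 < rho ^+ n by rewrite exprn_gt0.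
have := bern n; rewrite -(ler_pM2l r0) mulfV ?gt_eqF// => bn.
have r1 : rho ^+ n <= 1 by rewrite exprn_ile1 ?ltW.
rewrite mulrDr mulr1 lerD// -[leRHS]mul1r ler_pdivlMr// -mulrA.
apply: le_trans bn; rewrite ler_wpM2l ?ltW//; lra.
Qed.

Lemma expr_lin_vanishing rho (C x : R) : 0 < rho < 1 -> 0 <= C -> forall e, 0 < e ->
  exists N, forall n, (N <= n)%N -> C * (rho ^+ n * (x + n%:R)) < e.
Proof.
move=> rho01 C0 e e0; have /andP[rho0 rho1] := rho01.
(* One factor s^n of rho^n absorbs the linear term, the other tends to 0. *)
pose s := Num.sqrt rho; have s0 : 0 < s by rewrite sqrtr_gt0.
have s1 : s < 1 by rewrite -sqrtr1 ltr_sqrt.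
have sE : s * s = rho by rewrite -expr2 sqr_sqrtr ?ltW.
have [M M0 MP] : exists2 M : R, 0 <= M & forall n, s ^+ n * (1 + n%:R) <= M.
  by apply: expr_lin_bounded; rewrite s0.
pose D := C * (M * (1 + `|x|)).
have D0 : 0 <= D by rewrite !mulr_ge0.
have D1 : 0 < 1 + D by lra.
have /cvgrPdist_lt/(_ (e / (1 + D)) (divr_gt0 e0 D1))[N _ NP] :
  (fun n => s ^+ n) @ \oo --> (0 : R) by apply: cvg_expr; rewrite gtr0_norm.
exists N => n /NP /=; rewrite sub0r normrN gtr0_norm ?exprn_gt0// ltr_pdivlMr// => sn.
apply: le_lt_trans sn.
have -> : rho ^+ n = s ^+ n * s ^+ n by rewrite -exprMn sE.
have sn0 : 0 < s ^+ n by rewrite exprn_gt0.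
rewrite -mulrA mulrCA ler_pM2l//; apply: (@le_trans _ _ D); last by lra.
rewrite /D ler_wpM2l//; apply: le_trans (ler_wpM2r _ (MP n)); last by rewrite addr_ge0.
rewrite -mulrA ler_pM2l//; have := ler_norm x; have := normr_ge0 x.
have : 0 <= n%:R :> R by []. nra.
Qed.

Lemma ratr_normB_le (r : rat) n : ratr `|r - n%:R| <= ratr `|r| + n%:R :> R.
Proof.
have -> : n%:R = ratr `|n%:R : rat| :> R by rewrite normr_nat ratr_nat.
by rewrite -rmorphD ler_rat ler_normB.
Qed.

Lemma ts_mul_term_bound a f A rho (C : R) r n : 0 <= A -> 0 <= rho ->
  (forall n, absv (a n) <= A * rho ^+ n) -> 0 <= C ->
  (forall r, absv (f r) <= C * (1 + ratr `|r|)) ->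
  absv (a n * f (r - n%:R)) <= (A * C) * (rho ^+ n * (1 + ratr `|r| + n%:R)).
Proof.
move=> A0 rho0 aA C0 fC; rewrite absvM mulrACA; apply: ler_pM; rewrite ?absv_ge0//.
apply: le_trans (fC _) _; rewrite ler_wpM2l//; have := ratr_normB_le r n; lra.
Qed.

Lemma ts_mul_cvg a f r : geom_bounded a -> lin_growth f ->
  series (fun i => a i * f (r - i%:R)) @ \oo --> ts_mul a f r.
Proof.
move=> [A [rho [A0 rho01 aA]]] [C C0 fC]; apply: cvg_series_vanishing => e e0.
have rho0 : 0 <= rho by case/andP: rho01 => /ltW.
have [N NP] := @expr_lin_vanishing rho (A * C) (1 + ratr `|r|) rho01 (mulr_ge0 A0 C0) e e0.
by exists N => n /NP; apply: le_lt_trans; exact: ts_mul_term_bound.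
Qed.

Lemma lin_growth_ts_mul a f : geom_bounded a -> lin_growth f -> lin_growth (ts_mul a f).
Proof.
move=> ga gf; have [A [rho [A0 rho01 aA]]] := ga; have [C C0 fC] := gf.
have rho0 : 0 <= rho by case/andP: rho01 => /ltW.
have [M M0 MP] := expr_lin_bounded rho01.
exists (A * C * M) => [|r]; first by rewrite !mulr_ge0.
apply: (cvg_series_bound (ts_mul_cvg ga gf)) => i.
apply: le_trans (ts_mul_term_bound _ _ A0 rho0 aA C0 fC) _.
rewrite -[leRHS]mulrA ler_wpM2l ?mulr_ge0//.
have r0 : 0 <= ratr `|r| :> R by rewrite ler0q.
apply: le_trans (ler_wpM2r _ (MP i)); last by lra.
rewrite -mulrA ler_wpM2l ?exprn_ge0//; have : 0 <= i%:R :> R by []. nra.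
Qed.

(** The double sum is rearranged along antidiagonals; a term with i + j = n is at most a constant
    times rho^n (1 + |r| + n), which tends to 0. *)
Lemma ts_mulA a b f : geom_bounded a -> geom_bounded b -> lin_growth f ->
  ts_mul a (ts_mul b f) = ts_mul (ps_mul a b) f.
Proof.
move=> ga gb gf; apply/funext => r; apply/esym/cvg_absv_lim.
have [A [rho [A0 rho01 aA bA]]] := geom_bounded2 ga gb; have [C C0 fC] := gf.
have rho0 : 0 <= rho by case/andP: rho01 => /ltW.
pose t i j := a i * (b j * f (r - i%:R - j%:R)).
have -> : (fun i => ps_mul a b i * f (r - i%:R)) =
    (fun n => \sum_(i < n.+1) t i (n - i)%N).
  apply/funext => n; rewrite /ps_mul big_distrl; apply: eq_bigr => i _ /=.
  rewrite /t -mulrA; congr (_ * (_ * f _)).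
  by rewrite natrB ?leq_ord//; ring.
apply: (@cvg_series_triangle t
  (fun n => A * A * C * (rho ^+ n * (1 + ratr `|r| + n%:R)))
  (fun i => a i * ts_mul b f (r - i%:R))).
- move=> i j; rewrite /t absvM exprD -mulrA.
  apply: (@le_trans _ _ (A * rho ^+ i *
      (A * C * (rho ^+ j * (1 + ratr `|r - i%:R| + j%:R))))).
    by apply: ler_pM; rewrite ?absv_ge0// ts_mul_term_bound.
  rewrite natrD; have := ratr_normB_le r i => ri.
  have -> : forall x y z : R, A * x * (A * C * (y * z)) = A * A * C * (x * y) * z.
    by move=> *; ring.
  have c0 : 0 <= A * A * C * (rho ^+ i * rho ^+ j) by rewrite !mulr_ge0 ?exprn_ge0.
  have ij : 1 + ratr `|r - i%:R| + j%:R <= 1 + ratr `|r| + (i%:R + j%:R) :> R by lra.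
  by have := ler_wpM2l c0 ij; lra.
- by apply: expr_lin_vanishing => //; rewrite !mulr_ge0.
- by move=> i; apply: cvg_seriesZ; exact: ts_mul_cvg.
- by apply: ts_mul_cvg => //; exact: lin_growth_ts_mul.
Qed.

Lemma lin_growth_Phi m f : (0 < m)%N -> lin_growth f -> lin_growth (Phi m f).
Proof.
move=> m0 [C C0 fC]; exists C => // r; apply: le_trans (fC _) _.
rewrite ler_wpM2l// lerD2l ler_rat normrM normfV normr_nat.
by rewrite ler_pdivrMr ?ltr0n// ler_peMr ?normr_ge0// ler1n.
Qed.

Lemma Phi_ts_mul m a f : (0 < m)%N -> geom_bounded a -> lin_growth f ->
  Phi m (ts_mul a f) = ts_mul (ps_subst a m) (Phi m f).
Proof.
move=> m0 ga gf; apply/funext => r; apply/esym/cvg_absv_lim.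
have -> : (fun i => ps_subst a m i * Phi m f (r - i%:R)) = (fun i =>
    if (m %| i)%N then a (i %/ m)%N * f (r / m%:R - (i %/ m)%N%:R) else 0).
  apply/funext => i; rewrite /ps_subst /Phi; case: ifPn => [/dvdnP[k ->]|_].
    by rewrite mulnK// natrM mulrBl mulfK// pnatr_eq0 -lt0n.
  by rewrite mul0r.
apply: (cvg_series_dvdn (u := fun i => a i * f (r / m%:R - i%:R))) => //.
exact: ts_mul_cvg.
Qed.

Lemma ts_mulZ c a f r : geom_bounded a -> lin_growth f ->
  ts_mul a (fun s => c * f s) r = c * ts_mul a f r.
Proof.
move=> ga gf; apply: cvg_absv_lim.
have -> : (fun i => a i * (c * f (r - i%:R))) = (fun i => c * (a i * f (r - i%:R))).
  by apply/funext => i; rewrite mulrCA.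
by apply: cvg_seriesZ; exact: ts_mul_cvg.
Qed.

Lemma eq_ts_mul a f g r : (forall i : nat, f (r - i%:R) = g (r - i%:R)) ->
  ts_mul a f r = ts_mul a g r.
Proof. by move=> fg; rewrite /ts_mul; under eq_fun do rewrite fg. Qed.

End UltrametricSums.

(** * p-adic estimates *)

Section PadicNumbers.
Context {R : realType} {K : valuedField R} {p : nat}.
Hypotheses (p_prime : prime p) (absp : absv (p%:R : K) = p%:R^-1).
Implicit Types (x y z : K) (n m : nat).

Let p_gt0 : 0 < p%:R :> R. Proof. by rewrite ltr0n prime_gt0. Qed.
Let p_gt1 : 1 < p%:R :> R. Proof. by rewrite ltr1n prime_gt1. Qed.

Lemma absv_pX n : absv ((p ^ n)%:R : K) = p%:R ^- n.
Proof. by rewrite natrX absvX absp exprVn. Qed.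

Lemma absv_int_le1 (a : int) : absv (a%:~R : K) <= 1.
Proof. by case: a => a; rewrite ?NegzE ?mulrNz ?absvN absv_nat_le1. Qed.

Lemma absv_abszE (a : int) : absv (a%:~R : K) = absv (`|a|%N%:R : K).
Proof. by case: a => a; rewrite ?NegzE ?mulrNz ?absvN. Qed.

Lemma absv_nat_dvdn n m : (p ^ n %| m)%N -> absv (m%:R : K) <= p%:R ^- n.
Proof.
case/dvdnP => k ->; rewrite natrM absvM absv_pX ler_piMl ?absv_nat_le1//.
Qed.

(** A Bezout relation 1 = k p - a m would give |1| < 1 if |m| < 1. *)
Lemma absv_nat_coprime m : coprime p m -> absv (m%:R : K) = 1.
Proof.
move=> /eqP cpm; have [a _ /dvdnP[k]] := Bezoutl m (prime_gt0 p_prime); rewrite cpm => E.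
apply/eqP; rewrite eq_le absv_nat_le1 /= leNgt; apply/negP => m1.
have : absv (1 : K) < 1; last by rewrite absv1 ltxx.
have -> : (1 : K) = k%:R * p%:R - a%:R * m%:R.
  by rewrite -!natrM -E natrD addrK.
apply: absvB_lt; rewrite absvM; apply: le_lt_trans (ler_piMl _ (absv_nat_le1 _)) _;
  rewrite ?absv_ge0//.
by rewrite absp invf_lt1.
Qed.

Lemma absv_nat n : (0 < n)%N -> absv (n%:R : K) = p%:R ^- logn p n.
Proof.
move=> n0; have [m pm {1}->] := pfactor_coprime p_prime n0.
by rewrite natrM absvM absv_pX absv_nat_coprime// mul1r.
Qed.

Lemma absv_nat_ge n : (0 < n)%N -> n%:R^-1 <= absv (n%:R : K).
Proof.
move=> n0; rewrite absv_nat// lef_pV2 ?posrE ?exprn_gt0// ?ltr0n//.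
by rewrite -natrX ler_nat dvdn_leq// pfactor_dvdnn.
Qed.

Lemma natr_neq0 n : n.+1%:R != 0 :> K.
Proof. by rewrite -absv_eq0 absv_nat// invr_eq0 expf_neq0// gt_eqF. Qed.

Lemma intr_neq0 (a : int) : a != 0 -> a%:~R != 0 :> K.
Proof.
by move=> a0; rewrite -absv_eq0 absv_abszE absv_eq0; case: `|a|%N (absz_eq0 a) => [|n _];
  rewrite ?natr_neq0// eqxx (negPf a0).
Qed.

(** * The rational numbers inside [K] *)

Lemma ratr_frac (a b : int) : b != 0 -> ratr (a%:~R / b%:~R) = a%:~R / b%:~R :> K.
Proof.
move=> b0; set x : rat := _ / _.
have bQ : b%:~R != 0 :> rat by rewrite intr_eq0.
have E : numq x * b = a * denq x.
  apply: (@intr_inj rat); rewrite !rmorphM /= numqE /x; field.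
  by [].
rewrite /ratr; apply/eqP; rewrite eqr_div ?intr_neq0 ?denq_neq0//.
by rewrite -!rmorphM E.
Qed.

Lemma ratr_charD (x y : rat) : ratr (x + y) = ratr x + ratr y :> K.
Proof.
rewrite -{1}[x]divq_num_den -{1}[y]divq_num_den.
have dQ (z : rat) : (denq z)%:~R != 0 :> rat by rewrite intr_eq0 denq_neq0.
have dK (z : rat) : (denq z)%:~R != 0 :> K by rewrite intr_neq0// denq_neq0.
have -> : (numq x)%:~R / (denq x)%:~R + (numq y)%:~R / (denq y)%:~R =
  (numq x * denq y + numq y * denq x)%:~R / (denq x * denq y)%:~R :> rat.
  by rewrite !(rmorphM, rmorphD) /=; field; rewrite !dQ.
rewrite ratr_frac ?mulf_neq0 ?denq_neq0// !(rmorphM, rmorphD) /= /ratr.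
by field; rewrite !dK.
Qed.

Lemma ratr_charM (x y : rat) : ratr (x * y) = ratr x * ratr y :> K.
Proof.
rewrite -{1}[x]divq_num_den -{1}[y]divq_num_den mulf_div -!rmorphM ratr_frac.
  by rewrite !rmorphM mulf_div.
by rewrite mulf_neq0 ?denq_neq0.
Qed.

Lemma ratr_charN (x : rat) : ratr (- x) = - ratr x :> K.
Proof. by apply: (addIr (ratr x)); rewrite -ratr_charD !addNr (ratr_nat K 0). Qed.

(** Dwork's lemma uses z^p = z mod p, which can fail for integral elements of [K] but holds for
    p-integral rationals; the Artin-Hasse coefficients are therefore tracked as rationals. *)
Definition ratr_image : {pred K} := fun z : K => `[< exists y : rat, z = ratr y >].

Lemma ratr_imageP z : reflect (exists y : rat, z = ratr y) (z \in ratr_image).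
Proof. exact: asboolP. Qed.

Lemma ratr_image_nat n : n%:R \in ratr_image.
Proof. by apply/ratr_imageP; exists n%:R; rewrite ratr_nat. Qed.

Lemma ratr_image_natV n : n%:R^-1 \in ratr_image.
Proof.
apply/ratr_imageP; case: n => [|n]; first by exists 0; rewrite invr0 (ratr_nat K 0).
exists n.+1%:R^-1; apply: (mulfI (natr_neq0 n)); rewrite divff ?natr_neq0//.
by rewrite -[X in X * _](ratr_nat K) -ratr_charM divff// (ratr_nat K 1).
Qed.

Lemma ratr_imageD x y : x \in ratr_image -> y \in ratr_image -> x + y \in ratr_image.
Proof.
by move=> /ratr_imageP[a ->] /ratr_imageP[b ->]; apply/ratr_imageP; exists (a + b);
  rewrite ratr_charD.
Qed.

Lemma ratr_imageM x y : x \in ratr_image -> y \in ratr_image -> x * y \in ratr_image.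
Proof.
by move=> /ratr_imageP[a ->] /ratr_imageP[b ->]; apply/ratr_imageP; exists (a * b);
  rewrite ratr_charM.
Qed.

Lemma ratr_image_sum (I : Type) (r : seq I) (P : pred I) (F : I -> K) :
  (forall i, P i -> F i \in ratr_image) -> \sum_(i <- r | P i) F i \in ratr_image.
Proof.
move=> FQ; apply: (big_ind (fun x => x \in ratr_image)) => //.
  exact: (ratr_image_nat 0).
exact: ratr_imageD.
Qed.

Lemma absv_denq (x : rat) : ~~ (p%:Z %| denq x)%Z -> absv ((denq x)%:~R : K) = 1.
Proof. by move=> px; rewrite absv_abszE absv_nat_coprime// prime_coprime. Qed.

(** If p divided the denominator, the coprime numerator would be a unit and |x| would exceed 1. *)
Lemma denq_absv_le1 (x : rat) : absv (ratr x : K) <= 1 -> ~~ (p%:Z %| denq x)%Z.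
Proof.
rewrite /ratr absvM absvV => x1; apply/negP => pd.
have pn : absv ((numq x)%:~R : K) = 1.
  rewrite absv_abszE absv_nat_coprime//.
  have [k dk] : exists k, `|denq x|%N = (k * p)%N by apply/dvdnP.
  have := coprime_num_den x; rewrite dk coprimeMr => /andP[_].
  by rewrite coprime_sym.
have dlt : absv ((denq x)%:~R : K) < 1.
  rewrite absv_abszE; apply: le_lt_trans (absv_nat_dvdn (n := 1) _) _.
    by rewrite expn1.
  by rewrite expr1 invf_lt1.
have d0 : 0 < absv ((denq x)%:~R : K).
  by rewrite lt_neqAle absv_ge0 eq_sym absv_eq0 intr_neq0 ?denq_neq0.
by move: x1; rewrite pn mul1r invf_le1// leNgt dlt.
Qed.

Lemma absv_ratr_le1 (x : rat) : ~~ (p%:Z %| denq x)%Z -> absv (ratr x : K) <= 1.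
Proof. by move=> px; rewrite /ratr absvM absvV absv_denq// invr1 mulr1 absv_int_le1. Qed.

Lemma approx_nat (x : rat) M : ~~ (p%:Z %| denq x)%Z ->
  exists n, absv (ratr x - n%:R : K) <= p%:R ^- M.
Proof.
move=> px; have d1 := absv_denq px.
have d0 : (denq x)%:~R != 0 :> K by rewrite intr_neq0// denq_neq0.
have pM0 : (0 < p ^ M)%N by rewrite expn_gt0 prime_gt0.
have cop : coprime (p ^ M) `|denq x|%N by rewrite coprimeXl// prime_coprime.
have [c _] := Bezoutl `|denq x|%N pM0; rewrite (eqP cop) => pc.
have dE : (denq x)%:~R = `|denq x|%N%:R :> K by rewrite -{1}absz_denq.
(* Bezout gives 1 + c * denq = 0 mod p^M, so -c inverts the denominator. The residue of [a] mod p^M,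
   being nonnegative, is then the natural number sought. *)
pose a : int := - (numq x * c%:Z).
have le1 : absv (ratr x - a%:~R : K) <= p%:R ^- M.
  have -> : ratr x - a%:~R = (numq x)%:~R * (1 + c * `|denq x|)%N%:R / (denq x)%:~R :> K.
    by rewrite natrD natrM -dE /ratr /a rmorphN rmorphM /=; field.
  rewrite absvM absvV d1 invr1 mulr1 absvM.
  apply: le_trans (ler_piMl (absv_ge0 _) (absv_int_le1 _)) _.
  exact: absv_nat_dvdn.
exists `|(a %% (p ^ M)%N)%Z|%N.
have -> : ratr x - `|(a %% (p ^ M)%N)%Z|%N%:R =
    (ratr x - a%:~R) - - ((a %/ (p ^ M)%N)%Z%:~R * (p ^ M)%N%:R) :> K.
  have {1}-> : a%:~R = (a %/ (p ^ M)%N)%Z%:~R * (p ^ M)%N%:R +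
      `|(a %% (p ^ M)%N)%Z|%N%:R :> K.
    have -> : `|(a %% (p ^ M)%N)%Z|%N%:R = (a %% (p ^ M)%N)%Z%:~R :> K.
      by rewrite -[in RHS](gez0_abs (modz_ge0 a _))// eqz_nat -lt0n.
    by rewrite {1}(divz_eq a (p ^ M)%N) rmorphD rmorphM.
  by ring.
apply: absvB_le => //; rewrite absvN absvM absv_pX.
by rewrite ler_piMl ?absv_int_le1// invr_ge0 exprn_ge0// ltW.
Qed.

Lemma absv_prodB_le n (x y : nat -> K) (B : R) :
  (forall i, absv (x i) <= 1) -> (forall i, absv (y i) <= 1) ->
  (forall i, absv (x i - y i) <= B) -> 0 <= B ->
  absv (\prod_(i < n) x i - \prod_(i < n) y i) <= B.
Proof.
move=> x1 y1 xyB B0; elim: n => [|n IH]; first by rewrite !big_ord0 subrr absv0.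
rewrite !big_ord_recr /=; set X := \prod_(i < n) x i in IH *; set Y := \prod_(i < n) y i in IH *.
have -> : X * x n - Y * y n = (X - Y) * x n - - (Y * (x n - y n)) by ring.
apply: absvB_le; rewrite ?absvN absvM; last first.
  apply: le_trans (ler_piMl (absv_ge0 _) _) (xyB _).
  by rewrite absv_prod prodr_ile1// => i _; rewrite absv_ge0 y1.
by apply: le_trans (ler_piMr (absv_ge0 _) _) IH.
Qed.

Lemma absvXB_le m x y (B : R) : absv x <= 1 -> absv y <= 1 -> absv (x - y) <= B ->
  absv (x ^+ m - y ^+ m) <= B.
Proof.
move=> x1 y1 xyB; have := @absv_prodB_le m (fun=> x) (fun=> y) B.
rewrite !prodr_const card_ord; apply=> //; exact: le_trans (absv_ge0 _) xyB.
Qed.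

(** Modulo p, z may be replaced by a natural number, to which Fermat's little theorem applies. *)
Lemma absv_fermat z : z \in ratr_image -> absv z <= 1 -> absv (z ^+ p - z) <= p%:R^-1.
Proof.
case/ratr_imageP => x -> x1; have [n nx] := approx_nat 1 (denq_absv_le1 x1).
rewrite expr1 in nx.
have -> : ratr x ^+ p - ratr x =
  (ratr x ^+ p - n%:R ^+ p) - (- (n%:R ^+ p - n%:R) - - (ratr x - n%:R)) :> K by ring.
apply: absvB_le; first by apply: absvXB_le; rewrite ?absv_nat_le1.
apply: absvB_le; rewrite absvN// -natrX.
have nn : (n <= n ^ p)%N 
  by case: (n) => // k; have := @leq_pexp2l k.+1 1 p isT (prime_gt0 p_prime); rewrite expn1.
rewrite -natrB//; apply: le_trans (absv_nat_dvdn (n := 1) _) _; last by rewrite expr1.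
by rewrite expn1 -eqn_mod_dvd//; apply/eqP/fermat_little.
Qed.

Lemma prod_subr_nat n m : \prod_(i < m) (n%:R - i%:R) = (n ^_ m)%:R :> K.
Proof.
elim: m => [|m IH]; first by rewrite big_ord0.
rewrite big_ord_recr /= IH ffactnSr natrM; have [mn|nm] := leqP m n.
  by rewrite natrB.
by rewrite ffact_small// !mul0r.
Qed.

(** Integrality of the binomial coefficients of x: modulo the exact power of p in n!, x may be
    replaced by a natural number y, and n! divides y (y - 1) ... (y - n + 1). *)
Lemma absv_falling_le (x : rat) n : ~~ (p%:Z %| denq x)%Z ->
  absv (\prod_(i < n) (ratr x - i%:R) : K) <= absv (n`!%:R : K).
Proof.
move=> px; rewrite [leRHS]absv_nat ?fact_gt0//; set M := logn _ _.
have [y xy] := approx_nat M px.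
set X := \prod_(i < n) _; pose Y : K := \prod_(i < n) (y%:R - i%:R).
have -> : X = (X - Y) - (- Y) by ring.
have M0 : 0 <= p%:R ^- M :> R by rewrite invr_ge0 exprn_ge0// ltW.
apply: absvB_le; last first.
  rewrite absvN /Y prod_subr_nat absv_nat_dvdn// -bin_ffact dvdn_mull//.
  exact: pfactor_dvdnn.
apply: (@absv_prodB_le n (fun i => ratr x - i%:R) (fun i => y%:R - i%:R)) => // i.
- by apply: absvB_le; rewrite ?absv_ratr_le1 ?absv_nat_le1.
- by apply: absvB_le; rewrite ?absv_nat_le1.
- by rewrite opprB addrA subrK.
Qed.

(** Legendre's formula in recursive form: only the n %/ p multiples of p contribute. *)
Lemma absv_fact_rec n : absv (n`!%:R : K) = p%:R ^- (n %/ p) * absv ((n %/ p)`!%:R : K).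
Proof.
have p0 := prime_gt0 p_prime.
elim: n => [|n IH]; first by rewrite div0n expr0 invr1 mul1r.
rewrite factS natrM absvM IH divnS//; case: (boolP (p %| n.+1)%N) => pn; last first.
  by rewrite absv_nat_coprime ?prime_coprime// mul1r.
rewrite add1n factS [in RHS]natrM absvM.
have -> : n.+1 = (p * (n %/ p).+1)%N.
  by have := divnK pn; rewrite divnS// pn add1n mulnC => ->.
by rewrite natrM absvM absp exprS invfM; ring.
Qed.

(* The partial fractions of [n! / (z (z+1) ... (z+n))] have integer numerators. *)
Lemma absv_fact_div_prod n z (B : R) :
  (forall i, (i <= n)%N -> z + i%:R != 0 /\ absv (z + i%:R)^-1 <= B) ->
  absv (n`!%:R / \prod_(i < n.+1) (z + i%:R)) <= B.
Proof.
elim: n z => [|n IH] z zB.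
  by have [_] := zB 0%N isT; rewrite big_ord1 mul1r.
have z1 i : z + i.+1%:R = (z + 1) + i%:R by rewrite -natr1; ring.
have IH0 := IH z (fun i ni => zB i (leqW ni)).
have IH1 : absv (n`!%:R / \prod_(i < n.+1) (z + 1 + i%:R)) <= B.
  by apply: IH => i ni; rewrite -z1; exact: zB.
suff -> : n.+1`!%:R / \prod_(i < n.+2) (z + i%:R) =
    n`!%:R / \prod_(i < n.+1) (z + i%:R) - n`!%:R / \prod_(i < n.+1) (z + 1 + i%:R).
  exact: absvB_le.
set P := \prod_(i < n) (z + i.+1%:R).
have E0 : \prod_(i < n.+1) (z + i%:R) = z * P.
  by rewrite big_ord_recl addr0; congr (_ * _); apply: eq_bigr.
have E1 : \prod_(i < n.+1) (z + 1 + i%:R) = P * (z + n.+1%:R).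
  by rewrite big_ord_recr /= -z1; congr (_ * _); apply: eq_bigr => i _; rewrite -z1.
rewrite big_ord_recr /= E0 E1 factS natrM.
have nz0 : z != 0 by have [] := zB 0%N isT; rewrite addr0.
have nzn : z + n.+1%:R != 0 by have [] := zB n.+1 (leqnn _).
have nzP : P != 0.
  apply/prodf_neq0 => i _; have [] := zB i.+1 _ => //; exact: leqW (ltn_ord i).
by move: (n.+1%:R : K) nzn => N nzn; field; rewrite nzn nzP nz0.
Qed.

(** A nonzero integer N satisfies |N| >= 1/N up to sign, because the power of p dividing N is at
    most N; here N is the numerator of x + n, which is linear in n. *)
Lemma absv_ratr_addn_inv (x : rat) : ~~ (p%:Z %| denq x)%Z -> exists2 C : R, 0 <= C &
  forall n, ratr x + n%:R != 0 :> K -> absv (ratr x + n%:R : K)^-1 <= C * (1 + n%:R).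
Proof.
move=> px; pose a := `|numq x|%N; pose b := `|denq x|%N.
exists (a + b)%N%:R => // n xn0.
have d0 : (denq x)%:~R != 0 :> K by rewrite intr_neq0// denq_neq0.
have xE : ratr x + n%:R = (numq x + n%:Z * denq x)%:~R / (denq x)%:~R :> K.
  by rewrite rmorphD rmorphM /= /ratr; field.
set N := numq x + _ in xE.
have N0 : (0 < `|N|)%N.
  by rewrite absz_gt0; apply: contraNneq xn0; rewrite xE => ->; rewrite mul0r.
rewrite xE absvV absvM absvV absv_denq// invr1 mulr1 absv_abszE.
apply: (@le_trans _ _ (`|N|%N%:R)).
  rewrite -[leRHS]invrK lef_pV2 ?posrE ?invr_gt0 ?ltr0n ?absv_nat_ge//.
  by apply: lt_le_trans (absv_nat_ge N0); rewrite invr_gt0 ltr0n.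
rewrite nat1r -natrM ler_nat; apply: (@leq_trans (a + n * b)); last by nia.
have nb : `|(n%:Z * denq x)%R|%N = (n * b)%N by rewrite abszM.
by rewrite /N /a -nb; lia.
Qed.

End PadicNumbers.

(** * Integrality of the Artin-Hasse exponential *)

Lemma exprD_middle (A : comPzRingType) (x y : A) n :
  (x + y) ^+ n.+1 - x ^+ n.+1 - y ^+ n.+1 =
  \sum_(i < n) (x ^+ (n.+1 - i.+1) * y ^+ i.+1) *+ 'C(n.+1, i.+1).
Proof.
rewrite exprDn big_ord_recl big_ord_recr /= subn0 expr0 mulr1 bin0 mulr1n.
rewrite /bump leq0n add1n subnn expr0 mul1r binn mulr1n.
rewrite [_ + (_ + _)]addrC addrK.
by rewrite addrK; apply: eq_bigr => i _.
Qed.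

Section DworkLemma.
Context {R : realType} {K : valuedField R} {p : nat} (pi0 : K).
Hypotheses (p_prime : prime p) (absp : absv (p%:R : K) = p%:R^-1).
Hypotheses (pi0_gt0 : 0 < absv pi0) (pi0_exp : absv pi0 ^+ p.-1 = p%:R^-1).
Implicit Types (x y z : K) (n m : nat) (a b : nat -> K).

Let q := absv pi0.
Let p_gt0 : 0 < p%:R :> R. Proof. by rewrite ltr0n prime_gt0. Qed.
Let p_gt1 : 1 < p%:R :> R. Proof. by rewrite ltr1n prime_gt1. Qed.
Let char0 := @natr_neq0 R K p p_prime absp.

Lemma absv_pi0_lt1 : absv pi0 < 1.
Proof.
rewrite ltNge; apply/negP => q1; have : p%:R^-1 < 1 :> R by rewrite invf_lt1.
by rewrite -pi0_exp ltNge exprn_ege1.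
Qed.

Let q_lt1 := absv_pi0_lt1.

Lemma ler_absv_pi0X m n : (m <= n)%N -> absv pi0 ^+ n <= absv pi0 ^+ m.
Proof. by move=> mn; apply: ler_wiXn2l => //; exact: ltW. Qed.

Lemma absv_pi0_pX n : p%:R ^- n = absv pi0 ^+ (p.-1 * n) :> R.
Proof. by rewrite exprM pi0_exp exprVn. Qed.

(** With s(n) the sum of the base p digits, |n!| = |pi0|^(n - s(n)), and s(n) >= 1 for n > 0. *)
Lemma absv_fact_ge n : absv pi0 ^+ n.-1 <= absv (n`!%:R : K).
Proof.
have p1 := prime_gt1 p_prime.
elim/ltn_ind: n => -[|n] IH; first by rewrite absv1.
rewrite (absv_fact_rec p_prime absp) absv_pi0_pX.
have := IH (n.+1 %/ p)%N; rewrite ltn_Pdiv// => /(_ isT) IHn.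
apply: (@le_trans _ _ (q ^+ (p.-1 * (n.+1 %/ p)) * q ^+ (n.+1 %/ p).-1)).
  by rewrite -exprD; apply: ler_absv_pi0X; have := leq_divM n.+1 p; nia.
by rewrite ler_pM2l// exprn_gt0.
Qed.

Lemma absv_fact_inv_le n : absv (n`!%:R^-1 : K) <= absv pi0 ^- n.-1.
Proof.
rewrite absvV lef_pV2 ?posrE ?exprn_gt0 ?absv_fact_ge//.
by apply: lt_le_trans (absv_fact_ge n); rewrite exprn_gt0.
Qed.

(** Again |n!| = |pi0|^(n - s(n)). Each base p digit costs at most |pi0|^-(p-1) = p, and a number n
    > 0 with k + 1 digits is at least p^k, so the total cost is at most p n. *)
Lemma absv_fact_le n : absv (n`!%:R : K) <= absv pi0 ^+ n * (p%:R * (1 + n%:R)).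
Proof.
have p1 := prime_gt1 p_prime.
have small r : (r < p)%N -> 1 <= q ^+ r * p%:R.
  move=> rp; rewrite -[leLHS](mulVf (lt0r_neq0 p_gt0)) ler_pM2r//.
  by rewrite -pi0_exp; apply: ler_absv_pi0X; lia.
suff {n} main n : absv (n.+1`!%:R : K) <= q ^+ n.+1 * (p%:R * n.+1%:R).
  case: n => [|n]; first by rewrite expr0 mul1r addr0 mulr1 absv1 ltW.
  apply: le_trans (main n) _; rewrite ler_pM2l ?exprn_gt0// ler_pM2l//.
  by rewrite lerDr.
elim/ltn_ind: n => n IH.
rewrite (absv_fact_rec p_prime absp) absv_pi0_pX.
case E : (n.+1 %/ p)%N => [|m].
  rewrite muln0 expr0 mul1r absv1 mulrA.
  have np : (n.+1 < p)%N by rewrite ltnNge -divn_gt0 ?E// ltnW.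
  by apply: le_trans (small _ np) _; rewrite ler_peMr ?ler1n// mulr_ge0// ?exprn_ge0// ltW.
have mn : (m < n)%N by have := leq_divM n.+1 p; rewrite E; nia.
pose r := (n.+1 %% p)%N; have nE : n.+1 = (p * m.+1 + r)%N.
  by rewrite {1}(divn_eq n.+1 p) E mulnC.
apply: (@le_trans _ _ (q ^+ (p.-1 * m.+1) * (q ^+ m.+1 * (p%:R * m.+1%:R)))).
  by rewrite ler_pM2l ?exprn_gt0//; exact: IH.
rewrite mulrA -exprD.
have -> : (p.-1 * m.+1 + m.+1 = p * m.+1)%N by nia.
have -> : q ^+ n.+1 = q ^+ (p * m.+1) * q ^+ r by rewrite -exprD -nE.
rewrite -[leRHS]mulrA ler_pM2l ?exprn_gt0//.
have rp : (r < p)%N by rewrite ltn_mod; lia.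
apply: (@le_trans _ _ (1 * (p%:R * (m.+1%:R)))); first by rewrite mul1r.
have pm : p%:R * m.+1%:R <= n.+1%:R :> R by rewrite -natrM ler_nat nE leq_addr.
by rewrite [leRHS]mulrA; apply: ler_pM => //; apply: small.
Qed.

(** * Frobenius congruences modulo p *)

Definition integral_poly (f : {poly K}) := forall i, absv (f`_i : K) <= 1.

Lemma integral_polyM (B : R) (f g : {poly K}) : integral_poly f -> 0 <= B ->
  (forall i, absv (g`_i : K) <= B) -> forall i, absv ((f * g)`_i : K) <= B.
Proof.
move=> f1 B0 gB i; rewrite coefM; apply: absv_sum_le => // j _.
by rewrite absvM; apply: le_trans (ler_piMl (absv_ge0 _) (f1 _)) (gB _).
Qed.

Lemma integral_polyX f m : integral_poly f -> integral_poly (f ^+ m).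
Proof.
move=> f1; elim: m => [|m IH].
  by move=> i; rewrite expr0 coef1; case: eqP => _; rewrite ?absv1// absv0.
by rewrite exprS; exact: integral_polyM.
Qed.

Lemma integral_poly_frobenius f g n : integral_poly f -> integral_poly g ->
  absv (((f + g) ^+ p - f ^+ p - g ^+ p)`_n : K) <= p%:R^-1.
Proof.
move=> f1 g1; have -> : (f + g) ^+ p - f ^+ p - g ^+ p =
    \sum_(i < p.-1) (f ^+ (p - i.+1) * g ^+ i.+1) *+ 'C(p, i.+1).
  by have := exprD_middle f g p.-1; rewrite prednK ?prime_gt0.
rewrite coef_sum; apply: absv_sum_le => [|i _]; first by rewrite invr_ge0 ltW.
rewrite -mulr_natr -mulrA; apply: integral_polyM; rewrite ?invr_ge0 ?(ltW p_gt0)//.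
  exact: integral_polyX.
apply: integral_polyM; rewrite ?invr_ge0 ?(ltW p_gt0)//; first exact: integral_polyX.
move=> j; rewrite -polyC_natr coefC; case: eqP => _; last by rewrite absv0 invr_ge0 ltW.
rewrite -[p%:R^-1]/(p%:R ^- 1); apply: (absv_nat_dvdn absp).
by rewrite expn1 prime_dvd_bin//; have := ltn_ord i; have := prime_gt1 p_prime; lia.
Qed.

Lemma coef_ps_exp N a k n : (n < N)%N -> ps_exp a k n = ((\poly_(i < N) a i) ^+ k)`_n.
Proof.
elim: k n => [|k IH] n nN; first by rewrite expr0 coef1.
rewrite exprS coefM /ps_exp iterS; apply: eq_bigr => i _.
rewrite coef_poly ifT ?(leq_ltn_trans (leq_ord i) nN)//; congr (_ * _).
by apply: IH; exact: leq_ltn_trans (leq_subr _ _) nN.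
Qed.

(** Induction on the truncation degree: adjoining a monomial m changes f^p into f^p + m^p modulo p,
    and m^p is exactly the new term of the series in t^p. *)
Lemma ps_exp_frobenius a n : (forall i, absv (a i) <= 1) ->
  absv (ps_exp a p n - ps_subst (fun i => a i ^+ p) p n) <= p%:R^-1.
Proof.
move=> a1; rewrite (coef_ps_exp _ _ (ltnSn n)).
pose f N := \poly_(i < N) a i; pose g N := \poly_(i < N) (a i ^+ p).
have p0 := prime_gt0 p_prime.
have fE N : f N.+1 = f N + (a N)%:P * 'X^N.
  apply/polyP => i; rewrite coefD coefCM coefXn !coef_poly ltnS.
  by case: ltngtP => //; rewrite ?mulr1 ?mulr0 ?addr0 ?add0r// => ->.
have gE N : g N.+1 \Po 'X^p = (g N \Po 'X^p) + (a N ^+ p)%:P * 'X^(N * p).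
  have -> : g N.+1 = g N + (a N ^+ p)%:P * 'X^N.
    apply/polyP => i; rewrite coefD coefCM coefXn !coef_poly ltnS.
    by case: ltngtP => //; rewrite ?mulr1 ?mulr0 ?addr0 ?add0r// => ->.
  by rewrite comp_polyD comp_polyM comp_polyC comp_Xn_poly -exprM mulnC.
have f1 N : integral_poly (f N).
  by move=> i; rewrite coef_poly; case: ifP => _; rewrite ?absv0.
have main N i : absv ((f N ^+ p - (g N \Po 'X^p))`_i : K) <= p%:R^-1.
  elim: N => [|N IH].
    have -> : f 0%N = 0 by apply/polyP => j; rewrite coef_poly coef0.
    have -> : g 0%N = 0 by apply/polyP => j; rewrite coef_poly coef0.
    by rewrite comp_poly0 subr0 expr0n eqn0Ngt p0 coef0 absv0 invr_ge0 ltW.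
  rewrite gE fE; set m := (a N)%:P * 'X^N.
  have mp : m ^+ p = (a N ^+ p)%:P * 'X^(N * p) by rewrite exprMn -polyC_exp -exprM.
  rewrite -mp.
  have -> : (f N + m) ^+ p - ((g N \Po 'X^p) + m ^+ p) =
    ((f N + m) ^+ p - f N ^+ p - m ^+ p) - - (f N ^+ p - (g N \Po 'X^p)) by ring.
  rewrite coefB coefN; apply: absvB_le; rewrite ?absvN//.
  apply: integral_poly_frobenius => // j.
  by rewrite coefCM coefXn; case: eqP => _; rewrite ?mulr1 ?mulr0 ?absv0.
have := main n.+1 n; rewrite coefB; congr (absv (_ - _) <= _).
rewrite coef_comp_poly_Xn// /ps_subst; case: ifP => // _.
by rewrite coef_poly ltnS leq_div.
Qed.

(** The top coefficient enters a k-th power linearly, with factor k since the constant term is 1. In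
    Dwork's lemma [b] is the truncation of the series at degree n and k = p. *)
Lemma ps_exp_top a b k n : a 0%N = 1 -> (forall i, (i <= n)%N -> a i = b i) ->
  b n.+1 = 0 -> ps_exp a k n.+1 = k%:R * a n.+1 + ps_exp b k n.+1.
Proof.
move=> a0 ab bn; have b0 : b 0%N = 1 by rewrite -ab.
have one c j : c 0%N = 1 -> ps_exp c j 0%N = 1.
  by move=> c0; elim: j => [//|j IH]; rewrite /ps_exp iterS ps_mul_coef0 c0 mul1r.
elim: k => [|k IH]; first by rewrite mul0r add0r.
rewrite /ps_exp !iterS -!/(ps_exp _ k) /ps_mul.
rewrite big_ord_recl big_ord_recr [in RHS]big_ord_recl [in RHS]big_ord_recr /=.
rewrite a0 b0 bn /bump leq0n add1n subn0 subnn !mul1r one// mul0r mulr1 addr0 IH.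
set S := \sum_(i < n) _; set S' := \sum_(i < n) _; have -> : S = S'.
  apply: eq_bigr => i _; rewrite /bump leq0n add1n ab//; congr (_ * _).
  by apply: (eq_ps_exp k ab); have := ltn_ord i; lia.
by rewrite -natr1; ring.
Qed.

Definition artin_hasse_log : nat -> K :=
  fun n => \sum_(i < n.+1 | n == (p ^ i)%N) (p ^ i)%:R^-1.

(** At most one index fits, and i < p^i keeps it within the range. *)
Lemma sum_pX_cond n (F : nat -> K) i : n = (p ^ i)%N ->
  \sum_(j < n.+1 | n == (p ^ j)%N) F j = F i.
Proof.
move=> nE; have ni : (i < n.+1)%N by rewrite ltnS nE ltnW// ltn_expl// prime_gt1.
rewrite (big_pred1 (Ordinal ni))// => j; rewrite [X in X == _]nE eqn_exp2l ?prime_gt1// eq_sym.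
Qed.

Lemma sum_pX_cond0 n (F : nat -> K) : (forall i, n != p ^ i)%N ->
  \sum_(j < n.+1 | n == (p ^ j)%N) F j = 0.
Proof. by move=> nE; apply: big1 => j; rewrite (negPf (nE j)). Qed.

Lemma pX_cases n : (exists i, n = p ^ i)%N \/ (forall i, n != p ^ i)%N.
Proof.
have [[i nE]|nE] := pselect (exists i, n = p ^ i)%N; first by left; exists i.
by right => i; apply/eqP => niE; apply: nE; exists i.
Qed.

Lemma artin_hasse_log0 : artin_hasse_log 0%N = 0.
Proof.
rewrite /artin_hasse_log (sum_pX_cond0 (fun i => (p ^ i)%:R^-1))// => i.
by rewrite eq_sym -lt0n expn_gt0 prime_gt0.
Qed.

(** Multiplication by p turns t^(p^(i+1))/p^(i+1) into the i-th term evaluated at t^p, and the term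
    i = 0 leaves p t. *)
Lemma artin_hasse_log_mulp n : p%:R * artin_hasse_log n =
  ps_subst artin_hasse_log p n + (if n == 1%N then p%:R else 0).
Proof.
have p0 := prime_gt0 p_prime; have p1 := prime_gt1 p_prime.
have pK : p%:R != 0 :> K by rewrite -(prednK p0) char0.
rewrite {1}/artin_hasse_log; have [[[|i] nE]|nE] := pX_cases n.
- rewrite (sum_pX_cond (fun i => (p ^ i)%:R^-1) nE) nE expn0 invr1 mulr1 /ps_subst dvdn1.
  by rewrite gtn_eqF// add0r.
- rewrite (sum_pX_cond (fun i => (p ^ i)%:R^-1) nE) nE /ps_subst expnS dvdn_mulr// mulKn//.
  rewrite /artin_hasse_log (sum_pX_cond (fun i => (p ^ i)%:R^-1) (erefl (p ^ i)%N)).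
  rewrite [_ == 1%N]gtn_eqF ?addr0; last first.
    by rewrite (leq_trans p1)// leq_pmulr// expn_gt0 p0.
  by rewrite natrM invfM mulVKf.
- rewrite (sum_pX_cond0 (fun i => (p ^ i)%:R^-1) nE) mulr0 ifN ?addr0; last by have := nE 0%N.
  rewrite /ps_subst; case: ifPn => // /dvdnP[k nk].
  rewrite nk mulnK// /artin_hasse_log (sum_pX_cond0 (fun i => (p ^ i)%:R^-1))// => i.
  by apply: contraNneq (nE i.+1) => ki; rewrite nk ki expnSr.
Qed.

Lemma artin_hasse_log_expo_ratr n : ps_expo artin_hasse_log n \in @ratr_image R K.
Proof.
have rV := ratr_image_natV p_prime absp.
have rM := ratr_imageM p_prime absp.
have LQ i : artin_hasse_log i \in @ratr_image R K.
  by apply: (ratr_image_sum p_prime absp) => j _; exact: rV.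
have EQ k i : ps_exp artin_hasse_log k i \in @ratr_image R K.
  elim: k i => [|k IH] i; first by exact: ratr_image_nat.
  by apply: (ratr_image_sum p_prime absp) => j _; exact: rM.
by apply: (ratr_image_sum p_prime absp) => k _; apply: rM => //; exact: rV.
Qed.

Lemma absv_expo_p i : (0 < i)%N -> absv (p%:R ^+ i / i`!%:R : K) <= p%:R^-1.
Proof.
move=> i0; rewrite absvM absvX absp -pi0_exp -exprM.
apply: le_trans (ler_wpM2l _ (absv_fact_inv_le i)) _; first by rewrite exprn_ge0 ?ltW.
have p1 := prime_gt1 p_prime.
(* The denominator i! costs at most |pi0|^-(i-1), and (p-1) i - (i-1) >= p-1. *)
have -> : (p.-1 * i = (p.-1 * i - i.-1) + i.-1)%N by nia.
rewrite exprD mulfK ?expf_neq0 ?gt_eqF//; apply: ler_absv_pi0X; nia.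
Qed.

(* Dwork's lemma: [E^p = E(t^p) exp(pt)], where [exp(pt) = 1] mod [p] and, if the
   coefficients below [n] are integral, [E^p = E(t^p)] mod [p] up to [p e_n t^n]. *)
Lemma artin_hasse_integral n : absv (ps_expo artin_hasse_log n) <= 1.
Proof.
set E := ps_expo artin_hasse_log; have p0 := prime_gt0 p_prime.
have pK : p%:R != 0 :> K by rewrite -(prednK p0) char0.
have E0 : E 0%N = 1 by exact: ps_expo_coef0.
pose g n : K := if n == 1%N then p%:R else 0.
have g0 : g 0%N = 0 by [].
have fun_eq : ps_exp E p = ps_mul (ps_subst E p) (ps_expo g).
  rewrite (ps_exp_expo char0 _ artin_hasse_log0) (ps_subst_expo char0 p0 artin_hasse_log0).
  rewrite (ps_expoD char0) ?ps_subst_coef0 ?artin_hasse_log0//; congr ps_expo.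
  by apply/funext => m; rewrite artin_hasse_log_mulp.
have gE i : ps_expo g i = p%:R ^+ i / i`!%:R.
  have gX k m : ps_exp g k m = if m == k then p%:R ^+ k else 0.
    elim: k m => [|k IH] m; first by rewrite /ps_exp /= /ps_one; case: eqP.
    rewrite /ps_exp iterS -/(ps_exp g k); case: m => [|m].
      by rewrite ps_mul_coef0 g0 mul0r.
    rewrite /ps_mul 2!big_ord_recl big1 => [|j _]; last by rewrite mul0r.
    by rewrite g0 mul0r add0r addr0 /= subn1 IH eqSS; case: eqP; rewrite ?mulr0// exprS.
  rewrite /ps_expo /ps_comp big_ord_recr big1 /= => [|k _]; last first.
    by rewrite gX gtn_eqF ?mulr0.
  by rewrite gX eqxx add0r mulrC.
elim/ltn_ind: n => -[|n] IH; first by rewrite E0 absv1.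
pose b i := if (i <= n)%N then E i else 0.
have b1 i : absv (b i) <= 1 by rewrite /b; case: ifP => [/IH//|_]; rewrite absv0.
have Eb i : (i <= n)%N -> E i = b i by rewrite /b => ->.
have top : ps_exp E p n.+1 = p%:R * E n.+1 + ps_exp b p n.+1.
  by apply: ps_exp_top => //; rewrite /b ltnn.
have F1 := ps_exp_frobenius n.+1 b1.
set X := ps_exp b p _ in top F1; set Y := ps_subst _ _ _ in F1.
have RHS : ps_exp E p n.+1 = ps_subst E p n.+1 +
    \sum_(i < n.+1) ps_subst E p (n - i) * (p%:R ^+ i.+1 / i.+1`!%:R).
  rewrite fun_eq ps_mulC /ps_mul big_ord_recl subn0 gE expr0 fact0 divr1 mul1r.
  by congr (_ + _); apply: eq_bigr => i _; rewrite gE mulrC.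
have subst1 i : (i <= n)%N -> absv (ps_subst E p i) <= 1.
  move=> ni; rewrite /ps_subst; case: ifP => _; last by rewrite absv0.
  by apply: IH; rewrite ltnS (leq_trans (leq_div _ _)).
have pV0 : 0 <= p%:R^-1 :> R by rewrite invr_ge0 ltW.
have tail : absv (\sum_(i < n.+1) ps_subst E p (n - i) *
    (p%:R ^+ i.+1 / i.+1`!%:R) : K) <= p%:R^-1.
  apply: absv_sum_le => // i _; rewrite absvM.
  apply: le_trans (ler_piMl (absv_ge0 _) _) (absv_expo_p _) => //.
  by rewrite subst1 ?leq_subr.
have YE : absv (ps_subst E p n.+1 - Y) <= p%:R^-1.
  rewrite /Y /ps_subst; case: ifP => [pn|_]; last by rewrite subrr absv0.
  have np : (n.+1 %/ p <= n)%N by rewrite -ltnS ltn_Pdiv// prime_gt1.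
  rewrite /b np -absvN opprB; apply: (absv_fermat p_prime absp); last exact: IH.
  exact: artin_hasse_log_expo_ratr.
have : absv (p%:R * E n.+1) <= p%:R^-1.
  have -> : p%:R * E n.+1 = (ps_exp E p n.+1 - ps_subst E p n.+1) -
      ((X - Y) - (ps_subst E p n.+1 - Y)) by rewrite top; ring.
  apply: absvB_le; first by rewrite RHS addrAC subrr add0r.
  exact: absvB_le.
by rewrite absvM absp -[leRHS]mulr1 ler_pM2l// invr_gt0.
Qed.

End DworkLemma.

(** * The series theta, hat-theta_1 and sigma *)

Section DworkSeries.
Context {R : realType} {K : valuedField R} {p : nat} (pi0 : K).
Hypotheses (p_prime : prime p) (absp : absv (p%:R : K) = p%:R^-1).
Hypotheses (pi0_gt0 : 0 < absv pi0) (pi0_exp : absv pi0 ^+ p.-1 = p%:R^-1).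
Hypothesis pi0_root : series (fun i => pi0 ^+ (p ^ i) / (p ^ i)%:R) @ \oo --> (0 : K).
Implicit Types (n m : nat).

Let q := absv pi0.
Let p_gt0 := prime_gt0 p_prime.
Let p_gt1 := prime_gt1 p_prime.
Let char0 := @natr_neq0 R K p p_prime absp.
Let q_lt1 : q < 1 := absv_pi0_lt1 p_prime pi0_exp.

Definition root_term (i : nat) : K := pi0 ^+ (p ^ i) / (p ^ i)%:R.

Definition root_partial m : K := \sum_(i < m.+1) root_term i.

Definition theta_log : nat -> K := fun n => \sum_(i < n.+1 | n == (p ^ i)%N) root_term i.

Definition thetahat_log : nat -> K :=
  fun n => \sum_(i < n.+1 | n == (p ^ i)%N) root_partial i.

Definition thetahat1_log : nat -> K :=
  fun n => thetahat_log n - (if n == 1%N then pi0 else 0).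

Definition sigma_log : nat -> K :=
  fun n => (if n == 1%N then pi0 else 0) - (if n == p then pi0 else 0).

Lemma thetaE : theta p pi0 = ps_expo theta_log. Proof. by []. Qed.

Lemma sigmaE : sigma p pi0 = ps_expo sigma_log. Proof. by []. Qed.

Lemma pX_neq0 i : (0 != p ^ i)%N.
Proof. by rewrite eq_sym -lt0n expn_gt0 p_gt0. Qed.

Lemma pX_eq1 i : (p ^ i == 1)%N = (i == 0%N).
Proof. by rewrite -[1%N in LHS](expn0 p) eqn_exp2l. Qed.

Lemma pXS_eq i : (p ^ i.+1 == p)%N = (i == 0%N).
Proof. by rewrite -[X in (_ == X)%N](expn1 p) eqn_exp2l. Qed.

Lemma theta_log_pX i : theta_log (p ^ i) = root_term i.
Proof. exact: (sum_pX_cond p_prime root_term (erefl (p ^ i)%N)). Qed.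

Lemma theta_log_npX n : (forall i, n != p ^ i)%N -> theta_log n = 0.
Proof. exact: (sum_pX_cond0 root_term). Qed.

Lemma thetahat_log_pX i : thetahat_log (p ^ i) = root_partial i.
Proof. exact: (sum_pX_cond p_prime root_partial (erefl (p ^ i)%N)). Qed.

Lemma thetahat_log_npX n : (forall i, n != p ^ i)%N -> thetahat_log n = 0.
Proof. exact: (sum_pX_cond0 root_partial). Qed.

Lemma theta_log0 : theta_log 0%N = 0.
Proof. exact: theta_log_npX pX_neq0. Qed.

Lemma thetahat_log0 : thetahat_log 0%N = 0.
Proof. exact: thetahat_log_npX pX_neq0. Qed.

Lemma thetahat1_log0 : thetahat1_log 0%N = 0.
Proof. by rewrite /thetahat1_log thetahat_log0 subrr. Qed.

Lemma sigma_log0 : sigma_log 0%N = 0.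
Proof. by rewrite /sigma_log /= ltn_eqF// subrr. Qed.

Lemma theta_artin_hasse n : theta p pi0 n = pi0 ^+ n * ps_expo (artin_hasse_log (p := p)) n.
Proof.
transitivity (ps_expo (fun n => pi0 ^+ n * artin_hasse_log (p := p) n) n); last first.
  by rewrite (ps_expo_scale char0 pi0 (artin_hasse_log0 p_prime)).
congr (ps_expo _ n); apply/funext => m; rewrite /theta_log /artin_hasse_log big_distrr.
by apply: eq_bigr => i /eqP mE; rewrite /root_term -mE.
Qed.

Lemma geom_bounded_theta : geom_bounded (theta p pi0).
Proof.
exists 1, q; split=> // [|n]; first by rewrite pi0_gt0.
rewrite theta_artin_hasse absvM absvX mul1r ler_piMr ?exprn_ge0 ?(ltW pi0_gt0)//.
exact: artin_hasse_integral p_prime absp pi0_gt0 pi0_exp n.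
Qed.

(** At k = p^m the factor theta(t^(p^j)) contributes the root term of index m - j for j <= m and
    nothing for j > m, so a partial sum of the root equation appears. *)
Lemma sum_subst_theta_log n k : (k <= n)%N ->
  \sum_(0 <= j < n.+1) ps_subst theta_log (p ^ j) k = thetahat_log k.
Proof.
move=> kn; have [[m kE]|kE] := pX_cases (p := p) k; last first.
  rewrite thetahat_log_npX// big1// => j _; rewrite /ps_subst.
  case: ifPn => // /dvdnP[l lE]; rewrite lE mulnK ?expn_gt0 ?p_gt0// theta_log_npX// => i.
  by apply: contraNneq (kE (i + j)%N) => li; rewrite lE li expnD.
rewrite kE thetahat_log_pX (big_cat_nat (n := m.+1))//=; last first.
  by rewrite ltnS (leq_trans _ kn)// kE ltnW// ltn_expl.
rewrite [X in _ + X]big_nat_cond [X in _ + X]big1 ?addr0; last first.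
  move=> j /andP[/andP[mj _] _]; rewrite /ps_subst dvdn_Pexp2l//.
  by rewrite leqNgt mj.
rewrite /root_partial -(big_mkord xpredT root_term) [RHS]big_nat_rev /=.
apply: eq_big_nat => j /andP[_ jm]; rewrite add0n subSS.
rewrite /ps_subst dvdn_exp2l; last by rewrite -ltnS.
by rewrite -expnB ?theta_log_pX// -ltnS.
Qed.

Lemma thetahatE : thetahat p pi0 = ps_expo thetahat_log.
Proof.
apply/funext => n; rewrite /thetahat.
rewrite -(big_mkord xpredT (fun j => ps_subst (theta p pi0) (p ^ j))).
under eq_bigr do rewrite thetaE (ps_subst_expo char0) ?expn_gt0 ?p_gt0 ?theta_log0//.
rewrite (big_ps_mul_expo char0) => [|j]; last by rewrite ps_subst_coef0 theta_log0.
(* The coefficient of t^n in an exponential involves only the coefficients up to n of its logarithm,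
   so the truncated product suffices. *)
by apply: eq_ps_comp => k kn; exact: sum_subst_theta_log.
Qed.

Lemma thetahat1E : thetahat1 p pi0 = ps_expo thetahat1_log.
Proof.
rewrite /thetahat1 thetahatE (ps_inv_expo char0)// (ps_expoD char0) ?thetahat_log0//.
by rewrite oppr0.
Qed.

(** The exponent is p^(i+1) - (p-1)(i+1), which is at least p^i because i + 1 <= p^i. *)
Lemma absv_root_term i : absv (root_term i.+1) <= q ^+ (p ^ i).
Proof.
rewrite absvM absvX absvV (absv_pX absp) invrK.
have -> : p%:R ^+ i.+1 = q ^- (p.-1 * i.+1) :> R.
  by rewrite /q -(absv_pi0_pX pi0_exp) invrK.
have le1 : (p ^ i + p.-1 * i.+1 <= p ^ i.+1)%N.
  have := ltn_expl i p_gt1; rewrite expnS; nia.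
rewrite ler_pdivrMr ?exprn_gt0// -exprD.
exact: (ler_absv_pi0X p_prime pi0_gt0 pi0_exp).
Qed.

Lemma absv_root_partial m : absv (root_partial m) <= q ^+ (p ^ m).
Proof.
have -> : absv (root_partial m) = absv (0 - series root_term m.+1).
  by rewrite sub0r absvN seriesEord.
apply: (cvg_series_tail pi0_root) => [|[//|i] mi]; first by rewrite exprn_ge0 ?ltW.
apply: le_trans (absv_root_term i) _.
by apply: (ler_absv_pi0X p_prime pi0_gt0 pi0_exp); rewrite leq_exp2l.
Qed.

(** The bound q^n on a logarithm has to be brought to the form q r^n; as n >= 2 for the surviving
    terms, r = sqrt q will do. *)
Let rho : R := Num.sqrt q.
Let rho0 : 0 < rho. Proof. by rewrite sqrtr_gt0. Qed.
Let rho1 : rho < 1. Proof. by rewrite -sqrtr1 ltr_sqrt. Qed.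
Let rhoE : rho ^+ 2 = q. Proof. by rewrite sqr_sqrtr ?ltW. Qed.

Lemma absv_thetahat1_log n : absv (thetahat1_log n) <= q * rho ^+ n.
Proof.
have ge0 : 0 <= q * rho ^+ n by rewrite mulr_ge0 ?exprn_ge0// ltW.
rewrite /thetahat1_log; have [[[|i] nE]|nE] := pX_cases (p := p) n.
(* The linear term, too large for the exponential, is cancelled by the division by exp(pi0 t). *)
- move: ge0; rewrite nE thetahat_log_pX expn0 eqxx /root_partial big_ord1 /root_term.
  by rewrite expn0 expr1 divr1 subrr absv0.
- rewrite nE thetahat_log_pX pX_eq1 subr0 -nE; apply: le_trans (absv_root_partial _) _.
  have n2 : (2 <= n)%N by rewrite nE (leq_trans p_gt1)// expnS leq_pmulr// expn_gt0 p_gt0.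
  rewrite -nE -rhoE -exprM -exprD; apply: ler_wiXn2l; rewrite ?ltW//; lia.
- by rewrite thetahat_log_npX// ifN ?subrr ?absv0//; exact: (nE 0%N).
Qed.

(** The k-th power of f carries q^k, while 1/k! is at most q^-(k-1) for k > 0. *)
Lemma absv_ps_expo_le (f : nat -> K) r : 0 < r < 1 -> (forall n, absv (f n) <= q * r ^+ n) ->
  forall n, absv (ps_expo f n) <= r ^+ n.
Proof.
move=> /andP[r0 r1] fr n.
have fX k m : absv (ps_exp f k m) <= q ^+ k * r ^+ m.
  elim: k m => [|k IH] m.
    rewrite mul1r /ps_exp /= /ps_one; case: eqP => [->|_]; first by rewrite absv1.
    by rewrite absv0 exprn_ge0// ltW.
  rewrite /ps_exp iterS -/(ps_exp _ _).
  apply: absv_sum_le => [|i _]; first by rewrite mulr_ge0 ?exprn_ge0// ltW.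
  rewrite absvM exprS -[m in r ^+ m](subnKC (leq_ord i)) exprD mulrACA.
  by apply: ler_pM; rewrite ?absv_ge0.
apply: absv_sum_le => [|k _]; first by rewrite exprn_ge0// ltW.
rewrite absvM; apply: le_trans (ler_pM _ _ (absv_fact_inv_le p_prime absp pi0_gt0 pi0_exp k)
  (fX k n)) _; rewrite ?absv_ge0// mulrA ler_piMl ?exprn_ge0 ?(ltW r0)//.
rewrite mulrC ler_pdivrMr ?exprn_gt0// mul1r.
by apply: (ler_absv_pi0X p_prime pi0_gt0 pi0_exp); rewrite leq_pred.
Qed.

Lemma geom_bounded_expo (f : nat -> K) r : 0 < r < 1 -> (forall n, absv (f n) <= q * r ^+ n) ->
  geom_bounded (ps_expo f).
Proof.
move=> r01 fr; exists 1, r; split=> // n; rewrite mul1r; exact: absv_ps_expo_le.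
Qed.

Lemma geom_bounded_thetahat1 : geom_bounded (thetahat1 p pi0).
Proof.
rewrite thetahat1E; apply: (geom_bounded_expo _ absv_thetahat1_log).
by rewrite rho0.
Qed.

(** At t^(p^(i+1)) a partial sum of the root equation gains its next term; [sigma_log] accounts for
    the corrections pi0 t and pi0 t^p. *)
Lemma theta_log_sigma n :
  theta_log n + ps_subst thetahat1_log p n = thetahat1_log n + sigma_log n.
Proof.
rewrite /thetahat1_log /sigma_log /ps_subst; have [[[|i] nE]|nE] := pX_cases (p := p) n.
- rewrite nE theta_log_pX thetahat_log_pX expn0 dvdn1 gtn_eqF// eqxx.
  rewrite ltn_eqF// /root_partial big_ord1 /root_term expn0 expr1 divr1; ring.
- rewrite nE theta_log_pX thetahat_log_pX pX_eq1 pXS_eq expnS dvdn_mulr// mulKn//.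
  rewrite thetahat_log_pX pX_eq1 /root_partial [in RHS]big_ord_recr /=; ring.
- have n1 : (n == 1)%N = false by exact: negPf (nE 0%N).
  have np : (n == p)%N = false by have /negPf := nE 1%N; rewrite expn1.
  rewrite (theta_log_npX nE) (thetahat_log_npX nE) n1 np.
  case: ifPn => [/dvdnP[k nk]|_]; last by ring.
  have kE i : (k != p ^ i)%N.
    by apply: contraNneq (nE i.+1) => ki; rewrite nk ki expnSr.
  have k1 : (k == 1)%N = false by exact: negPf (kE 0%N).
  rewrite nk mulnK// thetahat_log_npX// k1; ring.
Qed.

Lemma theta_subst_thetahat1 :
  ps_mul (theta p pi0) (ps_subst (thetahat1 p pi0) p) = ps_mul (thetahat1 p pi0) (sigma p pi0).
Proof.
rewrite thetahat1E thetaE sigmaE (ps_subst_expo char0 p_gt0 thetahat1_log0).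
rewrite !(ps_expoD char0) ?ps_subst_coef0 ?theta_log0 ?thetahat1_log0 ?sigma_log0//.
by congr ps_expo; apply/funext => n; exact: theta_log_sigma.
Qed.

Lemma geom_bounded_sigma : geom_bounded (sigma p pi0).
Proof.
have -> : sigma p pi0 = ps_mul (ps_expo (fun n => - thetahat1_log n))
    (ps_mul (theta p pi0) (ps_subst (thetahat1 p pi0) p)).
  rewrite theta_subst_thetahat1 ps_mulA thetahat1E (ps_expoD char0) ?thetahat1_log0 ?oppr0//.
  rewrite (_ : (fun n => - thetahat1_log n) \+ thetahat1_log = fun=> 0).
    by rewrite (ps_expo0 char0) ps_mul1.
  by apply/funext => n /=; rewrite addNr.
apply: geom_boundedM.
  apply: (@geom_bounded_expo _ rho) => [|n]; first by rewrite rho0.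
  by rewrite absvN absv_thetahat1_log.
apply: geom_boundedM; first exact: geom_bounded_theta.
exact: geom_bounded_subst geom_bounded_thetahat1.
Qed.

(** The Euler derivation of the logarithm is pi0 t - p pi0 t^p. The guards have the shape of
    [cvg_series_shift]. *)
Lemma sigma_rec n : n%:R * sigma p pi0 n =
  (if (n < 1)%N then 0 else pi0 * sigma p pi0 (n - 1)) -
  (if (n < p)%N then 0 else p%:R * pi0 * sigma p pi0 (n - p)).
Proof.
have -> : n%:R * sigma p pi0 n = ps_mul (ps_deriv sigma_log) (sigma p pi0) n.
  by rewrite {2}sigmaE -(ps_deriv_expo char0 sigma_log0).
have part m x : \sum_(i < n.+1) (if val i == m then x else 0) * sigma p pi0 (n - i) =
    if (n < m)%N then 0 else x * sigma p pi0 (n - m).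
  case: ifPn => [nm|]; last rewrite -leqNgt => mn.
    apply: big1 => i _; have -> : (val i == m) = false; last by rewrite mul0r.
    by apply: ltn_eqF; exact: leq_ltn_trans (leq_ord i) nm.
  have mn1 : (m < n.+1)%N by [].
  rewrite (bigD1 (Ordinal mn1))//= eqxx big1 ?addr0// => i /negPf.
  by rewrite -val_eqE /= => ->; rewrite mul0r.
rewrite -(part 1%N pi0) -(part p (p%:R * pi0)) -sumrB; apply: eq_bigr => i _.
rewrite -mulrBl; congr (_ * _); rewrite /ps_deriv /sigma_log mulrBr /=.
by congr (_ - _); case: eqP => [->|_]; rewrite ?mulr0 ?mul1r.
Qed.

End DworkSeries.

(** * The series xi and its image *)

Section FractionalPowers.
Context {K : fieldType} (d : nat) (varpi pi0 : K).
Hypotheses (d_gt0 : (0 < d)%N) (varpi_root : varpi ^+ d = pi0) (pi0_neq0 : pi0 != 0).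

Lemma varpi_neq0 : varpi != 0.
Proof.
by apply: contraNneq pi0_neq0 => v0; rewrite -varpi_root v0 expr0n gtn_eqF.
Qed.

Lemma rpowD (r s : rat) : d%:R * r \is a Num.int ->
  rpow d varpi (r + s) = rpow d varpi r * rpow d varpi s.
Proof.
by move=> rd; rewrite /rpow mulrDr floorDzr// expfzDr// varpi_neq0.
Qed.

Lemma rpow_int (l : int) : rpow d varpi l%:~R = pi0 ^ l.
Proof.
by rewrite /rpow [d%:R]pmulrn -intrM intrKfloor -exprz_exp -exprnP varpi_root.
Qed.

Lemma rpow_neq0 (r : rat) : rpow d varpi r != 0.
Proof. by rewrite expfz_neq0// varpi_neq0. Qed.

End FractionalPowers.

Section Brackets.
Context {K : fieldType}.
Implicit Types (z : K) (l : int).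

Lemma bracketN z n : bracket z (- n%:Z) = \prod_(i < n) (z - i%:R).
Proof. by case: n => [|n] //=; rewrite ?big_ord0 ?invr1// -NegzE. Qed.

(** Denominators occur only for l > 0, where z + l is the last factor and must not vanish. *)
Lemma bracket_rec z l : (0 < l -> z + l%:~R != 0) ->
  (z + l%:~R) * bracket z l = bracket z (l - 1).
Proof.
case: l => [[|n]|n] zl.
- by rewrite addr0 sub0r (bracketN z 1) big_ord1 subr0 /= big_ord0 invr1 mulr1.
- rewrite -[n.+1 in RHS]addn1 PoszD addrK /= big_ord_recr /= invfM mulrC -mulrA mulVf ?mulr1//.
  exact: zl.
- have -> : Negz n - 1 = Negz n.+1 by rewrite !NegzE -opprD -PoszD addn1.
  by rewrite /= [RHS]big_ord_recr /= mulrC NegzE mulrNz.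
Qed.

Lemma rising_opp z n : rising (- z) n = (-1) ^+ n * \prod_(i < n) (z - i%:R).
Proof.
elim: n => [|n IH]; first by rewrite /rising !big_ord0 mul1r.
rewrite /rising big_ord_recr [in RHS]big_ord_recr /= -/(rising (- z) n) IH exprS; ring.
Qed.

Lemma bracket_opp1 l : bracket (-1 : K) l =
  if l <= 0 then (-1) ^+ `|l|%N * `|l|%N`!%:R else 0.
Proof.
have fact_prod n : \prod_(i < n) (-1 - i%:R) = (-1) ^+ n * n`!%:R :> K.
  elim: n => [|n IH]; first by rewrite big_ord0 mul1r.
  by rewrite big_ord_recr /= IH exprS factS natrM -natr1; ring.
case: l => [[|n]|n] /=; first by rewrite big_ord0 invr1 mul1r.
  by rewrite big_ord_recl /= addNr mul0r invr0.
by rewrite fact_prod.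
Qed.

End Brackets.

Section RationalSeries.
Context {R : realType} {K : valuedField R}.
Implicit Types (v r : rat) (c : int -> K) (f : rat -> K).

Lemma tseries_at v c (l : int) : tseries v c (v + l%:~R) = c l.
Proof. by rewrite /tseries addrC addKr intr_int intrKfloor. Qed.

Lemma tseries_out v c r : r - v \isn't a Num.int -> tseries v c r = 0.
Proof. by rewrite /tseries => /negPf ->. Qed.

Lemma int_shift v r : r - v \is a Num.int -> exists l : int, r = v + l%:~R.
Proof. by move=> /intrP[l rl]; exists l; rewrite -rl addrC subrK. Qed.

Lemma ts_mul_out v a f r : (forall s, s - v \isn't a Num.int -> f s = 0) ->
  r - v \isn't a Num.int -> ts_mul a f r = 0.
Proof.
move=> fv rv; apply: cvg_absv_lim; apply/cvg_absvP => e e0; exists 0%N => n _.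
rewrite subr0 seriesEord /= big1 ?absv0// => i _; rewrite fv ?mulr0//.
by rewrite addrAC rpredBr// intr_nat.
Qed.

Lemma tseriesE v f : (forall s, s - v \isn't a Num.int -> f s = 0) ->
  f = tseries v (fun l => f (v + l%:~R)).
Proof.
move=> fv; apply/funext => r; have [/int_shift[l ->]|rv] := boolP (r - v \is a Num.int).
  by rewrite tseries_at.
by rewrite fv// tseries_out.
Qed.

Lemma ratr_norm_intr (l : int) : ratr `|l%:~R : rat| = `|l|%N%:R :> R.
Proof. by rewrite -intr_norm -abszE ratr_nat. Qed.

Lemma lin_growth_tseries v c (C : R) : 0 <= C ->
  (forall l, absv (c l) <= C * (1 + `|l|%N%:R)) -> lin_growth (tseries v c).
Proof.
move=> C0 cC; have v0 : 0 <= ratr `|v| :> R by rewrite ler0q.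
exists (C * (1 + ratr `|v|)) => [|r]; first by rewrite mulr_ge0// addr_ge0.
have r0 : 0 <= ratr `|r| :> R by rewrite ler0q.
have [/int_shift[l rl]|rv] := boolP (r - v \is a Num.int); last first.
  by rewrite tseries_out// absv0 !mulr_ge0 ?addr_ge0.
rewrite {1}rl tseries_at; apply: le_trans (cC l) _; rewrite -mulrA ler_wpM2l//.
have : `|l|%N%:R <= ratr `|r| + ratr `|v| :> R.
  rewrite -ratr_norm_intr -rmorphD ler_rat.
  have -> : l%:~R = r - v by rewrite rl addrC addKr.
  exact: ler_normB.
nra.
Qed.

Lemma lin_growth_C_growth v f : lin_growth f -> C_growth (fun l => f (v + l%:~R)).
Proof.
move=> [C C0 fC] delta d01; have /andP[d0 d1] := d01.
have main (s : nat -> int) : (forall n, `|s n|%N = n) ->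
    (fun n => absv (f (v + (s n)%:~R)) * delta ^+ n) @ \oo --> (0 : R).
  move=> sn; apply/cvgrPdist_lt => e e0.
  have [N NP] := expr_lin_vanishing (1 + ratr `|v|) d01 C0 e0.
  exists N => // n /NP; apply: le_lt_trans.
  rewrite sub0r normrN ger0_norm ?mulr_ge0 ?absv_ge0 ?exprn_ge0 ?(ltW d0)//.
  rewrite mulrCA mulrC ler_wpM2l ?exprn_ge0 ?(ltW d0)//.
  apply: le_trans (fC _) _; rewrite ler_wpM2l// -addrA lerD2l.
  have := ler_normD v (s n)%:~R; rewrite -(ler_rat R) rmorphD /= => /le_trans; apply.
  by rewrite ratr_norm_intr sn.
by split; apply: main => n; rewrite ?abszN.
Qed.

Lemma lin_growth_gamma f : lin_growth f -> lin_growth (gamma f).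
Proof.
move=> [C C0 fC]; exists C => // r; rewrite /gamma; case: ifP => // _.
by rewrite absv0 mulr_ge0// addr_ge0// ler0q.
Qed.

End RationalSeries.

Section HypergeometricSeries.
Context {R : realType} {K : valuedField R} {p : nat} (pi0 : K).
Hypothesis K_complete : forall F : set_system K, ProperFilter F -> cauchy F -> cvg F.
Hypotheses (p_prime : prime p) (absp : absv (p%:R : K) = p%:R^-1).
Hypotheses (pi0_gt0 : 0 < absv pi0) (pi0_exp : absv pi0 ^+ p.-1 = p%:R^-1).
Hypothesis pi0_root : series (fun i => pi0 ^+ (p ^ i) / (p ^ i)%:R) @ \oo --> (0 : K).
Context (d : nat) (varpi : K).
Hypotheses (d_gt0 : (0 < d)%N) (varpi_root : varpi ^+ d = pi0).
Implicit Types (v r : rat).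

Let q := absv pi0.
Let q_lt1 : q < 1 := absv_pi0_lt1 p_prime pi0_exp.
Let p_gt0 := prime_gt0 p_prime.

Let pi0_neq0 : pi0 != 0.
Proof. by rewrite -absv_eq0 gt_eqF. Qed.

Lemma ratr_eq0 r : (ratr r == 0 :> K) = (r == 0).
Proof.
apply/eqP/eqP => [r0|->]; last exact: (ratr_nat K 0).
apply/eqP; rewrite -numq_eq0; apply/negPn/negP => n0.
move/eqP: r0; rewrite /ratr mulf_eq0 invr_eq0.
by rewrite !(negPf (intr_neq0 p_prime absp _)) ?denq_neq0.
Qed.

Lemma ratr_addz v (l : int) : ratr (v + l%:~R) = ratr v + l%:~R :> K.
Proof. by rewrite (ratr_charD p_prime absp) ratr_int. Qed.

Lemma ratr_opp1 : ratr (-1) = -1 :> K.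
Proof. by rewrite (ratr_int K (-1)). Qed.

(* For v = -1 the truncation to l <= 0 comes from the junk value 0 of [bracket]. *)
Lemma xiE v : xi d varpi v =
  tseries v (fun l => bracket (ratr v : K) l * rpow d varpi (v + l%:~R)).
Proof.
rewrite /xi; case: eqP => // ->; congr tseries; apply/funext => l.
by rewrite ratr_opp1 bracket_opp1; case: ifP => // _; rewrite mul0r.
Qed.

Lemma xi_at v (l : int) : d%:R * v \is a Num.int ->
  xi d varpi v (v + l%:~R) = rpow d varpi v * (bracket (ratr v) l * pi0 ^ l).
Proof.
move=> dv; rewrite xiE tseries_at /= (rpowD d_gt0 varpi_root pi0_neq0)//.
by rewrite (rpow_int varpi_root) mulrCA.
Qed.

Lemma xi_out v r : r - v \isn't a Num.int -> xi d varpi v r = 0.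
Proof. by move=> rv; rewrite xiE tseries_out. Qed.

(* The differential equation [t xi' = pi0 t xi], which for v = -1 fails only in
   the coefficient of t^0. *)
Lemma xi_rec v r : -1 <= v <= 0 -> d%:R * v \is a Num.int -> v != -1 \/ r < 0 ->
  ratr r * xi d varpi v r = pi0 * xi d varpi v (r - 1).
Proof.
move=> /andP[vm v0] dv vr; have [/int_shift[l rl]|rv] := boolP (r - v \is a Num.int).
  have -> : r - 1 = v + (l - 1)%:~R by rewrite rl rmorphB addrA.
  rewrite rl !xi_at// mulrCA [RHS]mulrCA; congr (_ * _).
  rewrite mulrA ratr_addz bracket_rec; last first.
    move=> l0; rewrite -ratr_addz ratr_eq0 -rl.
    have [vm1|r0] := vr; last by rewrite lt_eqF.
    rewrite gt_eqF// rl; have : 1 <= l%:~R :> rat by rewrite ler1z -gtz0_ge1.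
    by move: vm; rewrite le_eqVlt eq_sym (negPf vm1) /=; lra.
  by rewrite mulrCA; congr (_ * _); rewrite expfzDr// exprN1 mulrCA divff ?mulr1.
by rewrite !xi_out ?mulr0// addrAC rpredBr// ?(intr_int _ 1).
Qed.

(** For l > 0 partial fractions bound (l-1)! / ((v+1) ... (v+l)) linearly, and |pi0|^l <= |(l-1)!|.
    For l < 0 the falling factorial is at most |n!| with n = -l, and |n!| |pi0|^-n grows at most
    linearly. *)
Lemma lin_growth_xi v : ~~ (p%:Z %| denq v)%Z -> d%:R * v \is a Num.int ->
  lin_growth (xi d varpi v).
Proof.
move=> pv dv; have [C C0 vC] := absv_ratr_addn_inv p_prime absp pv.
rewrite xiE; set w := absv (rpow d varpi v).
have w0 : 0 <= w by exact: absv_ge0.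
pose B := C + p%:R + 1.
have B0 : 0 <= B by rewrite !addr_ge0.
apply: (@lin_growth_tseries _ _ _ _ (w * B)) => [|l]; first by rewrite mulr_ge0.
rewrite /= (rpowD d_gt0 varpi_root pi0_neq0)//.
rewrite (rpow_int varpi_root). rewrite mulrCA absvM.
rewrite -mulrA ler_wpM2l// absvM.
have p0 : 0 <= p%:R :> R by [].
case: l => [[|n]|n].
- by rewrite /= big_ord0 invr1 expr0z absv1 mulr1 addr0 mulr1 /B; lra.
- have nat0 : 0 <= n.+1%:R :> R by [].
  (* Where a denominator vanishes, [bracket] takes the default value 0 and the bound is trivial. *)
  have [/eqP z0|nz] := boolP (\prod_(i < n.+1) (ratr v + i.+1%:R) == 0 :> K).
    by rewrite /= z0 invr0 absv0 mul0r mulr_ge0// addr_ge0.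
  apply: (@le_trans _ _ (C * (1 + n.+1%:R))); last first.
    by apply: ler_wpM2r; rewrite ?addr_ge0// /B; lra.
  have nzi i : (i <= n)%N -> ratr v + i.+1%:R != 0 :> K.
    by move=> ni; move/prodf_neq0: nz => /(_ (Ordinal (ni : (i < n.+1)%N)) isT).
  have : absv (n`!%:R / \prod_(i < n.+1) (ratr v + 1 + i%:R) : K) <= C * (1 + n.+1%:R).
    apply: absv_fact_div_prod => i ni.
    have -> : ratr v + 1 + i%:R = ratr v + i.+1%:R :> K by rewrite -natr1; ring.
    split; first exact: nzi; apply: le_trans (vC _ (nzi _ ni)) _.
    by rewrite ler_wpM2l// lerD2l ler_nat.
  under eq_bigr do rewrite -addrA nat1r.
  rewrite absvM mulrC => /(le_trans _); apply.
  rewrite /= absvX; apply: ler_pM; rewrite ?absv_ge0 ?exprn_ge0 ?(ltW pi0_gt0)//.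
  apply: le_trans (absv_fact_ge p_prime absp pi0_gt0 pi0_exp n).
  by apply: (ler_absv_pi0X p_prime pi0_gt0 pi0_exp); lia.
- rewrite -[pi0 ^ Negz n]/(pi0 ^- n.+1) absvV absvX.
  apply: (@le_trans _ _ (p%:R * (1 + n.+1%:R))); last first.
    by apply: ler_wpM2r; rewrite ?addr_ge0// /B; lra.
  rewrite ler_pdivrMr ?exprn_gt0// mulrC.
  apply: le_trans (absv_falling_le p_prime absp n.+1 pv) _.
  exact: absv_fact_le p_prime absp pi0_gt0 pi0_exp n.+1.
Qed.

(** * The series sigma Phi xi: its recursion and its coefficient at t^(pv) *)

Section Recursion.
Variable v : rat.
Hypotheses (v_int : ~~ (p%:Z %| denq v)%Z) (v_itv : -1 <= v <= 0).
Hypothesis dv_int : d%:R * v \is a Num.int.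

Let g_sigma := geom_bounded_sigma p_prime absp pi0_gt0 pi0_exp pi0_root.
Let g_Phi := lin_growth_Phi p_gt0 (lin_growth_xi v_int dv_int).

Definition sigma_Phi_xi : rat -> K := ts_mul (sigma p pi0) (Phi p (xi d varpi v)).

Lemma sigma_Phi_xi_cvg r :
  series (fun i => sigma p pi0 i * Phi p (xi d varpi v) (r - i%:R)) @ \oo -->
  sigma_Phi_xi r.
Proof. exact: ts_mul_cvg. Qed.

(* [sigma] has logarithmic derivative [pi0 - p pi0 t^(p-1)], and the second term
   cancels the contribution of [Phi xi]: [sigma Phi xi] satisfies the same
   differential equation as [xi]. *)
Lemma sigma_Phi_xi_rec r : v != -1 \/ r < 0 ->
  ratr r * sigma_Phi_xi r = pi0 * sigma_Phi_xi (r - 1).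
Proof.
move=> vr; set f := Phi p (xi d varpi v).
have pQ : p%:R != 0 :> rat by rewrite pnatr_eq0 -lt0n.
have fE i : ratr (r - i%:R) * f (r - i%:R) = p%:R * pi0 * f (r - p%:R - i%:R).
  have sE : r - i%:R = p%:R * ((r - i%:R) / p%:R) by rewrite mulrCA divff ?mulr1.
  rewrite {1}sE (ratr_charM p_prime absp) ratr_nat -[LHS]mulrA -[RHS]mulrA /f /Phi xi_rec//.
    by congr (_ * (_ * xi _ _ _ _)); field.
  case: vr => [|r0]; [by left|right].
  by rewrite pmulr_llt0 ?invr_gt0 ?ltr0n// subr_lt0 (lt_le_trans r0).
rewrite -(cvg_absv_lim (cvg_seriesZ (c := ratr r) (@sigma_Phi_xi_cvg r))).
apply: cvg_absv_lim.
pose A i := if (i < 1)%N then 0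
  else pi0 * (sigma p pi0 (i - 1) * f (r - 1 - (i - 1)%N%:R)).
pose B i := if (i < p)%N then 0
  else p%:R * pi0 * (sigma p pi0 (i - p) * f (r - p%:R - (i - p)%N%:R)).
pose C i := p%:R * pi0 * (sigma p pi0 i * f (r - p%:R - i%:R)).
have -> : (fun i => ratr r * (sigma p pi0 i * f (r - i%:R))) =
    (fun i => (A i + -1 * B i) + C i).
  apply/funext => i.
  (* Leibniz rule: r = i + (r - i), where i differentiates sigma and r - i differentiates Phi xi. *)
  have -> : ratr r * (sigma p pi0 i * f (r - i%:R)) =
      (i%:R * sigma p pi0 i) * f (r - i%:R) +
      sigma p pi0 i * (ratr (r - i%:R) * f (r - i%:R)).
    rewrite (ratr_charD p_prime absp r) (ratr_charN p_prime absp) ratr_nat; ring.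
  rewrite fE (sigma_rec pi0 p_prime absp) /A /B /C.
  have shift m : (i < m)%N = false -> r - m%:R - (i - m)%N%:R = r - i%:R.
    by move=> /negbT; rewrite -leqNgt => mi; rewrite natrB//; ring.
  have shift1 := shift 1%N; have shiftp := shift p.
  case E1 : (i < 1)%N; case Ep : (i < p)%N; rewrite ?shift1 ?shiftp//; ring.
have -> : pi0 * sigma_Phi_xi (r - 1) = (pi0 * sigma_Phi_xi (r - 1) +
    -1 * (p%:R * pi0 * sigma_Phi_xi (r - p%:R))) + p%:R * pi0 * sigma_Phi_xi (r - p%:R).
  by ring.
apply: cvg_seriesD; last by apply: cvg_seriesZ; exact: sigma_Phi_xi_cvg.
apply: cvg_seriesD.
  apply: (cvg_series_shift (u := fun i => pi0 * (sigma p pi0 i * f (r - 1 - i%:R)))).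
  by apply: cvg_seriesZ; exact: sigma_Phi_xi_cvg.
apply: cvg_seriesZ.
apply: (cvg_series_shift
  (u := fun i => p%:R * pi0 * (sigma p pi0 i * f (r - p%:R - i%:R)))).
by apply: cvg_seriesZ; exact: sigma_Phi_xi_cvg.
Qed.

(** Only the indices i = p l of sigma meet the support of Phi xi; they pair with the coefficients
    [v]_(-l) = (-1)^l (-v)_l of xi at v - l. Convergence of [H] is obtained along the way. *)
Lemma sigma_Phi_xi_start :
  sigma_Phi_xi (p%:R * v) = rpow d varpi v * H p pi0 (- ratr v).
Proof.
have pQ : p%:R != 0 :> rat by rewrite pnatr_eq0 -lt0n.
pose h l := (-1) ^+ l * rising (- ratr v) l * sigma p pi0 (p * l)%N * pi0 ^- l : K.
set w := rpow d varpi v; have w0 : w != 0 by exact: rpow_neq0 d_gt0 varpi_root pi0_neq0 _.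
suff hv : series (fun l => w * h l) @ \oo --> sigma_Phi_xi (p%:R * v).
  have hw : series h @ \oo --> w^-1 * sigma_Phi_xi (p%:R * v).
    rewrite (_ : h = fun l => w^-1 * (w * h l)); first exact: cvg_seriesZ.
    by apply/funext => l; rewrite mulKf.
  by rewrite /H (cvg_absv_lim hw) mulVKf.
apply: (cvg_series_dvdnV p_gt0).
have -> : (fun i => if (p %| i)%N then w * h (i %/ p)%N else 0) =
    (fun i => sigma p pi0 i * Phi p (xi d varpi v) (p%:R * v - i%:R)).
  apply/funext => i; rewrite /Phi.
  have -> : (p%:R * v - i%:R) / p%:R = v - i%:R / p%:R by field.
  case: ifPn => [/dvdnP[l ->]|pi].
    rewrite mulnK// natrM mulfK//.
    have -> : v - l%:R = v + (- l%:Z)%:~R by rewrite rmorphN.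
    rewrite xi_at// bracketN /h rising_opp -exprnN mulnC -/w.
    have : (-1) ^+ l * (-1) ^+ l = 1 :> K by rewrite -expr2 sqrr_sign.
    set s := (-1) ^+ l; set P := \prod_(_ < _) _ => ss.
    transitivity ((s * s) * (w * P * sigma p pi0 (l * p) * pi0 ^- l)); first by ring.
    by rewrite ss; ring.
  rewrite xi_out ?mulr0//; apply: contra pi => /intrP[z zE].
  have iE : i%:Z = - z * p%:Z.
    apply: (@intr_inj rat); rewrite rmorphM rmorphN /= -zE; field.
    by [].
  have : (p%:Z %| i%:Z)%Z by apply/dvdzP; exists (- z).
  by [].
exact: sigma_Phi_xi_cvg.
Qed.

Lemma sigma_Phi_xi_out r : r - p%:R * v \isn't a Num.int -> sigma_Phi_xi r = 0.
Proof.
apply: ts_mul_out => s sv; rewrite /Phi xi_out//; apply: contra sv => /intrP[z zE].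
have pQ : p%:R != 0 :> rat by rewrite pnatr_eq0 -lt0n.
apply/intrP; exists (p%:Z * z); rewrite rmorphM /= -zE; field.
by [].
Qed.

(** * Comparison with the series of v' *)

Variable v' : rat.
Hypothesis v'_shift : is_prime_shift p v v'.

(** For 0 < n < p the integer n is a unit, while |p v| <= 1/p. This settles the end points v' = 0
    and v' = -1. *)
Lemma ratr_mulp_nat_eq0 n : p%:R * v = - n%:R -> (n < p)%N -> n = 0%N.
Proof.
move=> pv np; apply/eqP/negPn/negP => n0.
have cn : coprime p n by rewrite prime_coprime// gtnNdvd// lt0n.
have : absv (n%:R : K) <= p%:R^-1.
  have -> : n%:R = - (p%:R * ratr v) :> K.
    by rewrite -(ratr_nat K p) -(ratr_charM p_prime absp) pv (ratr_charN p_prime absp)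
      ratr_nat opprK.
  rewrite absvN absvM absp ler_piMr ?invr_ge0//.
  exact: (absv_ratr_le1 p_prime absp v_int).
rewrite (absv_nat_coprime p_prime absp cn) leNgt invf_lt1 ?ltr0n//.
by rewrite ltr1n prime_gt1.
Qed.

Lemma prime_shift_cases : [/\ -1 <= v' <= 0, (v == -1) = (v' == -1) &
  exists m, [/\ (m < p)%N, p%:R * v = v' - m%:R & v' = 0 -> m = 0%N]].
Proof.
have [v'_itv [m mp vE]] := v'_shift.
have pvE : p%:R * v = v' - m%:R by rewrite -vE; ring.
split=> //; last first.
  by exists m; split=> // v'0; apply: ratr_mulp_nat_eq0 mp; rewrite pvE v'0 sub0r.
have /andP[lo hi] := v'_itv.
have mp1 : m%:R + 1 <= p%:R :> rat by rewrite natr1 ler_nat.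
apply/eqP/eqP => [v1|v'1].
  move: pvE; rewrite v1 mulrN1 => pvE; lra.
(* Here p v = -(m + 1): either m + 1 = p and v = -1, or m + 1 < p, which p-integrality excludes. *)
move: mp; rewrite leq_eqVlt => /orP[/eqP mp|mp].
  have pQ : p%:R != 0 :> rat by rewrite pnatr_eq0 -lt0n.
  by apply: (mulfI pQ); rewrite pvE v'1 -mp -natr1; ring.
have := ratr_mulp_nat_eq0 _ mp; rewrite pvE v'1 -natr1 => /(_ _)/eqP.
by have -> : -1 - m%:R = - (m%:R + 1) :> rat by [ring]; move=> /(_ erefl).
Qed.

Lemma shift_int : d%:R * v' \is a Num.int.
Proof.
have [_ _ [m [_ pvE _]]] := prime_shift_cases.
have -> : v' = p%:R * v + m%:R by rewrite pvE; ring.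
by rewrite mulrDr mulrCA rpredD// rpredM// ?intr_nat.
Qed.

Lemma lin_growth_xi_shift : lin_growth (xi d varpi v').
Proof.
apply: lin_growth_xi shift_int; apply: (denq_absv_le1 p_prime absp).
have [_ _ [m [_ pvE _]]] := prime_shift_cases.
have -> : v' = p%:R * v + m%:R by rewrite pvE; ring.
rewrite (ratr_charD p_prime absp) (ratr_charM p_prime absp) !ratr_nat.
have -> : p%:R * ratr v + m%:R = p%:R * ratr v - - m%:R :> K by ring.
apply: absvB_le; rewrite ?absvN ?absv_nat_le1// absvM.
apply: le_trans (ler_piMl (absv_ge0 _) (absv_nat_le1 _)) _.
exact: (absv_ratr_le1 p_prime absp v_int).
Qed.

Definition dwork_factor : K := rpow d varpi (- (p%:R - 1) * v) *
  (H p pi0 (- ratr v) / bracket (ratr v') (Num.floor (p%:R * v - v'))).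

Lemma sigma_Phi_xi_shift_start :
  sigma_Phi_xi (p%:R * v) = dwork_factor * xi d varpi v' (p%:R * v).
Proof.
have [_ _ [m [mp pvE v'0]]] := prime_shift_cases.
have mE : - m%:R = (- m%:Z)%:~R :> rat by rewrite rmorphN.
have flE : Num.floor (p%:R * v - v') = - m%:Z.
  have -> : p%:R * v - v' = (- m%:Z)%:~R by rewrite pvE -mE; ring.
  exact: intrKfloor.
rewrite sigma_Phi_xi_start /dwork_factor flE pvE mE xiE tseries_at -mE -pvE.
(* As v' <= 0, a factor v' - i vanishes only for v' = 0 and i = 0; but then m = 0 and the product is
   empty. *)
set b := bracket _ _; have b0 : b != 0.
  rewrite /b bracketN; apply/prodf_neq0 => i _.
  rewrite -(ratr_nat K i) -(ratr_charN p_prime absp) -(ratr_charD p_prime absp) ratr_eq0.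
  rewrite subr_eq0; apply/eqP => v'i.
  have i0 : i = 0%N :> nat.
    have [/andP[_ ]] := prime_shift_cases; rewrite v'i -[0]/(0%N%:R) ler_nat leqn0.
    by move=> /eqP.
  have m0 : m = 0%N by apply: v'0; rewrite v'i i0.
  by have := leq_trans (ltn_ord i) (eq_leq m0).
have -> : rpow d varpi v =
    rpow d varpi (- (p%:R - 1) * v) * rpow d varpi (p%:R * v).
  rewrite -(rpowD d_gt0 varpi_root pi0_neq0); last first.
    by rewrite mulrCA rpredM// rpredN rpredB// ?intr_nat// (intr_int _ 1).
  by congr rpow; ring.
by field.
Qed.

Lemma sigma_Phi_xiE r : v != -1 \/ r < 0 ->
  sigma_Phi_xi r = dwork_factor * xi d varpi v' r.
Proof.
have [v'_itv v1 [m [mp pvE v'0]]] := prime_shift_cases.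
have step s : v != -1 \/ s < 0 ->
    ratr s * (sigma_Phi_xi s - dwork_factor * xi d varpi v' s) =
    pi0 * (sigma_Phi_xi (s - 1) - dwork_factor * xi d varpi v' (s - 1)).
  move=> vs; rewrite mulrBr sigma_Phi_xi_rec// mulrCA.
  rewrite (xi_rec v'_itv shift_int) -?v1//; ring.
have pQ : 0 < p%:R :> rat by rewrite ltr0n.
have [/int_shift[l rl]|rv] := boolP (r - p%:R * v \is a Num.int); last first.
  rewrite sigma_Phi_xi_out// xi_out ?mulr0//; apply: contra rv => rv'.
  have -> : r - p%:R * v = r - v' + m%:R by rewrite pvE; ring.
  by rewrite rpredD// intr_nat.
move=> vr; apply/eqP; rewrite -subr_eq0; apply/eqP; move: vr; rewrite {r}rl.
have start : sigma_Phi_xi (p%:R * v) - dwork_factor * xi d varpi v' (p%:R * v) = 0.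
  by rewrite sigma_Phi_xi_shift_start subrr.
case: l => n; last first.
  (* Downwards from p v, each step divides by pi0; for v = -1 the exponents stay negative. *)
  move=> _; rewrite NegzE; elim: n.+1 => {n} [|n IH]; first by rewrite oppr0 addr0.
  apply: (mulfI pi0_neq0); rewrite mulr0.
  have -> : p%:R * v + (- n.+1%:Z)%:~R = p%:R * v + (- n%:Z)%:~R - 1.
    by rewrite !rmorphN /= -!pmulrn -natr1; ring.
  rewrite -step ?IH ?mulr0//; have [v1'|] := eqVneq v (-1); [right|by left].
  rewrite v1' rmorphN /= -pmulrn; have : 0 <= n%:R :> rat by []. lra.
elim: n => [|n IH] vr; first by rewrite addr0.
have r1 : p%:R * v + n.+1%:Z%:~R - 1 = p%:R * v + n%:Z%:~R.
  by rewrite -!pmulrn -natr1; ring.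
have := step _ vr; rewrite r1 IH; last first.
  case: vr => [|vr]; [by left|right]; rewrite -r1; lra.
rewrite mulr0 => /eqP; rewrite mulf_eq0 => /orP[|/eqP//].
(* Upwards, a step fails only at r = 0. Then v' is an integer in ]-1, 0], so v' = 0 and m = n + 1,
   whereas v' = 0 forces m = 0. *)
rewrite ratr_eq0 => /eqP r0; exfalso.
case: vr => [vn1|]; last by rewrite r0 ltxx.
have v'n : v' = m%:R - n.+1%:R by move: r0; rewrite pvE -pmulrn; lra.
have /andP[lo hi] := v'_itv; move: vn1; rewrite v1 => vn1.
have lo' : -1 < v' by rewrite lt_neqAle eq_sym vn1.
have : (m <= n.+1)%N by rewrite -(ler_nat rat); move: hi; rewrite v'n; lra.
have : (n.+1 < m.+1)%N by rewrite -(ltr_nat rat) -natr1; move: lo'; rewrite v'n; lra.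
move=> nm mn; have mE : m = n.+1 by lia.
by have := v'0; rewrite v'n mE subrr => /(_ erefl).
Qed.

(** * The operator [alphahat] on hat-xi, including the truncated case v = -1 *)

Let g_theta := geom_bounded_theta p_prime absp pi0_gt0 pi0_exp.
Let g_thetahat1 := geom_bounded_thetahat1 p_prime absp pi0_gt0 pi0_exp pi0_root.
Let g_xi := lin_growth_xi v_int dv_int.

Lemma theta_Phi_thetahat1_xi :
  ts_mul (theta p pi0) (Phi p (ts_mul (thetahat1 p pi0) (xi d varpi v))) =
  ts_mul (thetahat1 p pi0) sigma_Phi_xi.
Proof.
rewrite Phi_ts_mul// ts_mulA//; last exact: geom_bounded_subst.
by rewrite (theta_subst_thetahat1 pi0 p_prime absp) -ts_mulA.
Qed.

Lemma thetahat1_xi_out s : s - v \isn't a Num.int ->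
  ts_mul (thetahat1 p pi0) (xi d varpi v) s = 0.
Proof. by apply: ts_mul_out; exact: xi_out. Qed.

Lemma xihat_dom : xihat p d pi0 varpi v \in alphahat_dom v.
Proof.
rewrite inE /xihat /alphahat_dom; set F := ts_mul _ _.
have gF : lin_growth F by exact: lin_growth_ts_mul.
have [v1|_] := eqVneq v (-1).
  exists (fun l => gamma F (-1 + l%:~R)); split.
  - by apply: lin_growth_C_growth; exact: lin_growth_gamma.
  - by move=> l l0; rewrite /gamma gerDl lerz0 leNgt l0.
  - apply: tseriesE => s sv; rewrite /gamma /F thetahat1_xi_out ?if_same//.
    by rewrite v1.
exists (fun l => F (v + l%:~R)); first exact: lin_growth_C_growth.
by apply: tseriesE => s sv; exact: thetahat1_xi_out.
Qed.

(** If s/p <= -1 the coefficient is kept by [gamma]; otherwise -1 < s/p < 0 is not an integer, and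
    the coefficient is already 0 because for v = -1 the exponents are integers. *)
Lemma gamma_Phi s : v = -1 -> s <= -1 ->
  Phi p (gamma (ts_mul (thetahat1 p pi0) (xi d varpi v))) s =
  Phi p (ts_mul (thetahat1 p pi0) (xi d varpi v)) s.
Proof.
move=> v1 s1; rewrite /Phi /gamma; case: ifPn => //; rewrite -ltNge => sp.
rewrite thetahat1_xi_out// v1 opprK; apply/negP => /intrP[z zE].
have : s / p%:R < 0 by rewrite pmulr_llt0 ?invr_gt0 ?ltr0n//; lra.
have z0 : 0 < z by rewrite -(ltr0z rat) -zE; lra.
have : 1 <= z%:~R :> rat by rewrite ler1z -gtz0_ge1.
rewrite -zE; lra.
Qed.

Lemma alphahat_xihat r : alphahat p pi0 v (xihat p d pi0 varpi v) r =
  dwork_factor * xihat p d pi0 varpi v' r.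
Proof.
have [_ v1 _] := prime_shift_cases.
have scale s : v != -1 \/ s < 0 -> ts_mul (thetahat1 p pi0) sigma_Phi_xi s =
    dwork_factor * ts_mul (thetahat1 p pi0) (xi d varpi v') s.
  move=> vs; rewrite -ts_mulZ//; last exact: lin_growth_xi_shift.
  (* The coefficient at s reads only exponents s - i <= s, so the negative range is closed under
     this multiplication. *)
  apply: eq_ts_mul => i; apply: sigma_Phi_xiE.
  by case: vs => [|s0]; [left|right; rewrite subr_lt0 (lt_le_trans s0)].
rewrite /alphahat /xihat -v1; have [vE|vn] := eqVneq v (-1); last first.
  by rewrite theta_Phi_thetahat1_xi scale//; left.
rewrite /gamma -/(gamma _); case: ifPn => r1; last by rewrite mulr0.
rewrite -scale; last by right; lra.
rewrite -theta_Phi_thetahat1_xi; apply: eq_ts_mul => i.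
by apply: gamma_Phi => //; apply: le_trans r1; rewrite gerBl.
Qed.

End Recursion.

End HypergeometricSeries.

Lemma ord_eq (R : realType) (K : valuedField R) (p : nat) (x : K) (s : R) :
  (1 < p)%N -> ord p x = s%:E -> 0 < absv x /\ ln (absv x) = - s * ln p%:R.
Proof.
rewrite /ord => p1; have [->|x0] := eqVneq x 0 => //.
have lnp : 0 < ln p%:R :> R by rewrite ln_gt0// ltr1n.
move=> [<-]; split; first by rewrite lt_neqAle absv_ge0 eq_sym absv_eq0 x0.
by rewrite opprK divfK// gt_eqF.
Qed.

Unset Implicit Arguments.
Set Strict Implicit.

Theorem theorem8p2 (R : realType) (p : nat) (K : valuedField R)
    (p_prime : prime p) (K_Cp : is_Cp K p)
    (N : nat) (v v' : 'I_N -> rat)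
    (v_int : forall j, ~~ (p%:Z %| denq (v j))%Z)
    (v_itv : forall j, -1 <= v j <= 0)
    (v'_def : forall j, is_prime_shift p (v j) (v' j))
    (pi0 : K)
    (pi0_root : series (fun i => pi0 ^+ (p ^ i) / (p ^ i)%:R) @ \oo --> (0 : K))
    (pi0_ord : ord p pi0 = ((p.-1)%:R^-1)%:E)
    (d : nat) (d_gt0 : (0 < d)%N)
    (dv_int : forall j, d%:R * v j \is a Num.int)
    (varpi : K) (varpi_root : varpi ^+ d = pi0)
    (j : 'I_N) :
  xihat p d pi0 varpi (v j) \in alphahat_dom (v j) /\
  forall r : rat,
    alphahat p pi0 (v j) (xihat p d pi0 varpi (v j)) r =
    rpow d varpi (- (p%:R - 1) * v j)
      * (H p pi0 (- ratr (v j))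
           / bracket (ratr (v' j)) (Num.floor (p%:R * v j - v' j)))
      * xihat p d pi0 varpi (v' j) r.
Proof.
have p_gt1 := prime_gt1 p_prime.
have [pi0_gt0 lnpi0] := ord_eq p_gt1 pi0_ord.
have absp := Cp_absp K_Cp.
have pi0_exp : absv pi0 ^+ p.-1 = p%:R^-1.
  apply: ln_inj; rewrite ?posrE ?exprn_gt0 ?invr_gt0 ?ltr0n ?prime_gt0//.
  rewrite lnXn// lnV ?posrE ?ltr0n ?prime_gt0// lnpi0 -mulr_natl.
  have p1 : p.-1%:R != 0 :> R by rewrite pnatr_eq0 -lt0n; lia.
  by field.
have complete := Cp_complete K_Cp.
split; first exact: (xihat_dom complete p_prime absp pi0_gt0 pi0_exp pi0_root
  d_gt0 varpi_root (v_int j) (dv_int j)).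
exact: (alphahat_xihat complete p_prime absp pi0_gt0 pi0_exp pi0_root
  d_gt0 varpi_root (v_int j) (v_itv j) (dv_int j) (v'_def j)).
Qed.
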